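(* Let $\mathbb K$ be an algebraically closed field of characteristic $3$, let $\varepsilon\in\mathbb K$, $\varepsilon\neq0$, and let $\mathfrak g=\mathfrak{br}(2;\varepsilon)=\mathfrak g(A)$ be the Lie algebra with Cartan matrix $$A=\begin{pmatrix}2&-1\\-2&1-\varepsilon\end{pmatrix},$$ with basis of the positive part $x_1$, $x_2$, $x_3=[x_1,x_2]$, $x_4=-\operatorname{ad}_{x_2}^2(x_1)$. Then $H^1(\mathfrak g;\mathfrak g)=0$ and $H^2(\mathfrak g)=0$.
   Context: For an invertible $n\times n$ matrix $A$: $\tilde{\mathfrak g}(A)$ is the Lie algebra generated by $h_i,x_i,y_i$ $(1\le i\le n)$ with relations $[h_i,h_j]=0$, $[h_i,x_j]=A_{ij}x_j$, $[h_i,y_j]=-A_{ij}y_j$, $[x_i,y_j]=\delta_{ij}h_i$; $\mathfrak g(A)$ is its quotient by the largest ideal that is graded with respect to the $\mathbb Z^n$-grading $\deg x_i=e_i=-\deg y_i$ and intersects $\operatorname{Span}(h_i)$ trivially. $H^1(\mathfrak g;\mathfrak g)$ is the space of derivations modulo inner ones, $H^2(\mathfrak g)$ is Chevalley--Eilenberg cohomology with trivial coefficients. *)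

(* Defs.v *)
From HB Require Import structures.
From mathcomp Require Import all_boot all_order all_algebra.
From mathcomp Require Import boolp classical_sets functions.

Set Implicit Arguments.
Unset Strict Implicit.
Unset Printing Implicit Defensive.

Import GRing.Theory.
Local Open Scope ring_scope.
Local Open Scope quotient_scope.

HB.mixin Record Lmodule_isLieAlgebra (K : fieldType) L of GRing.Lmodule K L := {
  lie : L -> L -> L;
  lie_linearl : forall (a : K) (u v w : L),
    lie (a *: u + v) w = a *: lie u w + lie v w;
  lie_linearr : forall (a : K) (u v w : L),
    lie w (a *: u + v) = a *: lie w u + lie w v;
  liexx : forall u : L, lie u u = 0;
  lie_jacobi : forall u v w : L,
    lie u (lie v w) + lie v (lie w u) + lie w (lie u v) = 0
}.

#[short(type="lieAlgType")]
HB.structure Definition LieAlgebra (K : fieldType) :=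
  {L of GRing.Lmodule K L & Lmodule_isLieAlgebra K L}.

Section LieTheory.
Variables (K : fieldType) (L : lieAlgType K).
Implicit Types u v w : L.

Lemma lie0l u : lie 0 u = 0.
Proof.
have := lie_linearl 1 0 0 u; rewrite !scale1r addr0 => E.
by apply: (addrI (lie 0 u)); rewrite -E addr0.
Qed.

Lemma lie0r u : lie u 0 = 0.
Proof.
have := lie_linearr 1 0 0 u; rewrite !scale1r addr0 => E.
by apply: (addrI (lie u 0)); rewrite -E addr0.
Qed.

Lemma lieDl u v w : lie (u + v) w = lie u w + lie v w.
Proof. by have := lie_linearl 1 u v w; rewrite !scale1r. Qed.

Lemma lieDr u v w : lie w (u + v) = lie w u + lie w v.
Proof. by have := lie_linearr 1 u v w; rewrite !scale1r. Qed.

Lemma lieZl a u v : lie (a *: u) v = a *: lie u v.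
Proof. by have := lie_linearl a u 0 v; rewrite !addr0 lie0l addr0. Qed.

Lemma lieZr a u v : lie u (a *: v) = a *: lie u v.
Proof. by have := lie_linearr a v 0 u; rewrite !addr0 lie0r addr0. Qed.

Lemma lieC u v : lie u v = - lie v u.
Proof.
apply/eqP; rewrite -addr_eq0; apply/eqP.
by have := liexx (u + v); rewrite lieDl !lieDr !liexx add0r addr0.
Qed.

Lemma lie_leibniz u v w : lie u (lie v w) = lie (lie u v) w + lie v (lie u w).
Proof.
apply/eqP; rewrite -subr_eq0 opprD [lie (lie u v) w]lieC opprK addrA.
rewrite -[X in _ - X]opprK [lie u w]lieC -[- lie w u]scaleN1r lieZr scaleN1r !opprK.
by rewrite addrAC lie_jacobi.
Qed.

End LieTheory.

(* [submodClosed] does not declare closure under opposite, which the quotients of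
   [ring_quotient] require. *)
Definition lmod_sub (K : fieldType) (V : lmodType K) (S : submodClosed V) :
  {pred V} := S.

Fact lmod_sub_zmod_closed (K : fieldType) (V : lmodType K) (S : submodClosed V) :
  zmod_closed (lmod_sub S).
Proof.
split=> [|u v uS vS]; first exact: (rpred0 S).
by rewrite -scaleN1r; apply: (rpredD (S := S)) => //; apply: (rpredZ (s := S)).
Qed.

HB.instance Definition _ (K : fieldType) (V : lmodType K) (S : submodClosed V) :=
  GRing.isZmodClosed.Build V (lmod_sub S) (lmod_sub_zmod_closed S).

Definition lmod_quot (K : fieldType) (V : lmodType K) (S : submodClosed V) :=
  Quotient.quot (lmod_sub S).

Section LmodQuotient.
Variables (K : fieldType) (V : lmodType K) (S : submodClosed V).

HB.instance Definition _ := GRing.Zmodule.on (lmod_quot S).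

Definition lmod_proj (v : V) : lmod_quot S := \pi_(Quotient.quot (lmod_sub S)) v.

Lemma lmod_projP u v : lmod_proj u = lmod_proj v <-> u - v \in S.
Proof.
rewrite -[_ \in S]/(_ \in lmod_sub S) Quotient.idealrBE.
by split=> [/eqP|/eqP].
Qed.

Lemma lmod_projD u v : lmod_proj (u + v) = lmod_proj u + lmod_proj v.
Proof. exact: (raddfD (\pi_(Quotient.quot (lmod_sub S)))). Qed.

Lemma lmod_proj0 : lmod_proj 0 = 0.
Proof. exact: (raddf0 (\pi_(Quotient.quot (lmod_sub S)))). Qed.

Definition lmod_lift (q : lmod_quot S) : V := repr (q : Quotient.quot (lmod_sub S)).

Lemma lmod_liftK q : lmod_proj (lmod_lift q) = q.
Proof. exact: reprK. Qed.

Lemma lmod_projK v : lmod_lift (lmod_proj v) - v \in S.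
Proof. by apply/lmod_projP; rewrite lmod_liftK. Qed.

Definition lmod_quot_scale (a : K) (q : lmod_quot S) := lmod_proj (a *: lmod_lift q).

Lemma lmod_quot_scaleE a v : lmod_quot_scale a (lmod_proj v) = lmod_proj (a *: v).
Proof. by apply/lmod_projP; rewrite -scalerBr rpredZ ?lmod_projK. Qed.

Fact lmod_quot_scalerA a b q :
  lmod_quot_scale a (lmod_quot_scale b q) = lmod_quot_scale (a * b) q.
Proof. by rewrite -[q]lmod_liftK !lmod_quot_scaleE scalerA. Qed.

Fact lmod_quot_scale1r : left_id 1 lmod_quot_scale.
Proof. by move=> q; rewrite -[q]lmod_liftK !lmod_quot_scaleE scale1r. Qed.

Fact lmod_quot_scalerDr : right_distributive lmod_quot_scale +%R.
Proof.
move=> a p q; rewrite -[p]lmod_liftK -[q]lmod_liftK -lmod_projD.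
by rewrite !lmod_quot_scaleE scalerDr lmod_projD.
Qed.

Fact lmod_quot_scalerDl q : {morph lmod_quot_scale^~ q : a b / a + b}.
Proof.
by move=> a b /=; rewrite -[q]lmod_liftK !lmod_quot_scaleE scalerDl lmod_projD.
Qed.

HB.instance Definition _ := GRing.Zmodule_isLmodule.Build K (lmod_quot S)
  lmod_quot_scalerA lmod_quot_scale1r lmod_quot_scalerDr lmod_quot_scalerDl.

Lemma lmod_projZ a v : lmod_proj (a *: v) = a *: lmod_proj v.
Proof. by rewrite -lmod_quot_scaleE. Qed.

End LmodQuotient.

Inductive lterm (K : fieldType) (n : nat) : Type :=
| TH of 'I_n
| TX of 'I_n
| TY of 'I_n
| TZero
| TOpp of lterm K n
| TAdd of lterm K n & lterm K n
| TScale of K & lterm K n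
| TLie of lterm K n & lterm K n.

Arguments TH {K n}. Arguments TX {K n}. Arguments TY {K n}. Arguments TZero {K n}.

HB.instance Definition _ (K : fieldType) n := gen_eqMixin (lterm K n).
HB.instance Definition _ (K : fieldType) n := gen_choiceMixin (lterm K n).

Section Presentation.
Variables (K : fieldType) (n : nat) (A : 'M[K]_n).

(* The least congruence on terms containing the axioms of Lie algebras and the
   defining relations. *)
Inductive lrel : lterm K n -> lterm K n -> Prop :=
| lrel_refl t : lrel t t
| lrel_sym t u : lrel t u -> lrel u t
| lrel_trans t u v : lrel t u -> lrel u v -> lrel t v
| lrel_Opp t t' : lrel t t' -> lrel (TOpp t) (TOpp t')
| lrel_Add t t' u u' : lrel t t' -> lrel u u' -> lrel (TAdd t u) (TAdd t' u')
| lrel_Scale a t t' : lrel t t' -> lrel (TScale a t) (TScale a t')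
| lrel_Lie t t' u u' : lrel t t' -> lrel u u' -> lrel (TLie t u) (TLie t' u')
| lrel_addA t u v : lrel (TAdd t (TAdd u v)) (TAdd (TAdd t u) v)
| lrel_addC t u : lrel (TAdd t u) (TAdd u t)
| lrel_add0 t : lrel (TAdd TZero t) t
| lrel_addN t : lrel (TAdd (TOpp t) t) TZero
| lrel_scaleA a b t : lrel (TScale a (TScale b t)) (TScale (a * b) t)
| lrel_scale1 t : lrel (TScale 1 t) t
| lrel_scaleDr a t u :
    lrel (TScale a (TAdd t u)) (TAdd (TScale a t) (TScale a u))
| lrel_scaleDl a b t :
    lrel (TScale (a + b) t) (TAdd (TScale a t) (TScale b t))
| lrel_linearl a t u v :
    lrel (TLie (TAdd (TScale a t) u) v) (TAdd (TScale a (TLie t v)) (TLie u v))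
| lrel_linearr a t u v :
    lrel (TLie v (TAdd (TScale a t) u)) (TAdd (TScale a (TLie v t)) (TLie v u))
| lrel_liexx t : lrel (TLie t t) TZero
| lrel_jacobi t u v :
    lrel (TAdd (TAdd (TLie t (TLie u v)) (TLie u (TLie v t))) (TLie v (TLie t u)))
         TZero
| lrel_HH i j : lrel (TLie (TH i) (TH j)) TZero
| lrel_HX i j : lrel (TLie (TH i) (TX j)) (TScale (A i j) (TX j))
| lrel_HY i j : lrel (TLie (TH i) (TY j)) (TScale (- A i j) (TY j))
| lrel_XY i j : lrel (TLie (TX i) (TY j)) (if i == j then TH i else TZero).

Definition lrelb (t u : lterm K n) : bool := `[< lrel t u >].

Fact lrelb_equiv : equiv_class_of lrelb.
Proof.
split=> [t|t u|u t v].
- exact/asboolP/lrel_refl.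
- by apply/asboolP/asboolP => /lrel_sym.
- by move=> /asboolP tu /asboolP uv; apply/asboolP/(lrel_trans tu uv).
Qed.

Canonical lrelb_equivRel := EquivRelPack lrelb_equiv.
Canonical lrelb_encModRel := defaultEncModRel lrelb.

Definition tilde_g := {eq_quot lrelb}.

HB.instance Definition _ := Choice.on tilde_g.
HB.instance Definition _ := EqQuotient.on tilde_g.

Definition tg_class (t : lterm K n) : tilde_g := \pi_tilde_g t.

Lemma tg_classP t u : tg_class t = tg_class u <-> lrel t u.
Proof.
split=> [/eqquotP|tu]; first by move/asboolP.
exact/eqquotP/asboolP.
Qed.

Definition tg_repr (q : tilde_g) : lterm K n := repr q.

Lemma tg_reprK q : tg_class (tg_repr q) = q.
Proof. exact: reprK. Qed.

Lemma tg_classK t : lrel (tg_repr (tg_class t)) t.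
Proof. by apply/tg_classP; rewrite tg_reprK. Qed.

Definition tg_add (p q : tilde_g) := tg_class (TAdd (tg_repr p) (tg_repr q)).
Definition tg_opp (p : tilde_g) := tg_class (TOpp (tg_repr p)).
Definition tg_scale (a : K) (p : tilde_g) := tg_class (TScale a (tg_repr p)).
Definition tg_lie (p q : tilde_g) := tg_class (TLie (tg_repr p) (tg_repr q)).

Lemma tg_addE t u : tg_add (tg_class t) (tg_class u) = tg_class (TAdd t u).
Proof. by apply/tg_classP/lrel_Add; apply: tg_classK. Qed.

Lemma tg_oppE t : tg_opp (tg_class t) = tg_class (TOpp t).
Proof. by apply/tg_classP/lrel_Opp; apply: tg_classK. Qed.

Lemma tg_scaleE a t : tg_scale a (tg_class t) = tg_class (TScale a t).
Proof. by apply/tg_classP/lrel_Scale; apply: tg_classK. Qed.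

Lemma tg_lieE t u : tg_lie (tg_class t) (tg_class u) = tg_class (TLie t u).
Proof. by apply/tg_classP/lrel_Lie; apply: tg_classK. Qed.

Let tgE := (tg_addE, tg_oppE, tg_scaleE, tg_lieE).

Fact tg_addA : associative tg_add.
Proof.
move=> p q r; rewrite -[p]tg_reprK -[q]tg_reprK -[r]tg_reprK !tgE.
exact/tg_classP/lrel_addA.
Qed.

Fact tg_addC : commutative tg_add.
Proof.
by move=> p q; rewrite -[p]tg_reprK -[q]tg_reprK !tgE; apply/tg_classP/lrel_addC.
Qed.

Fact tg_add0 : left_id (tg_class TZero) tg_add.
Proof. by move=> p; rewrite -[p]tg_reprK !tgE; apply/tg_classP/lrel_add0. Qed.

Fact tg_addN : left_inverse (tg_class TZero) tg_opp tg_add.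
Proof. by move=> p; rewrite -[p]tg_reprK !tgE; apply/tg_classP/lrel_addN. Qed.

HB.instance Definition _ :=
  GRing.isZmodule.Build tilde_g tg_addA tg_addC tg_add0 tg_addN.

Fact tg_scalerA a b p : tg_scale a (tg_scale b p) = tg_scale (a * b) p.
Proof. by rewrite -[p]tg_reprK !tgE; apply/tg_classP/lrel_scaleA. Qed.

Fact tg_scale1r : left_id 1 tg_scale.
Proof. by move=> p; rewrite -[p]tg_reprK !tgE; apply/tg_classP/lrel_scale1. Qed.

Fact tg_scalerDr : right_distributive tg_scale +%R.
Proof.
move=> a p q; rewrite -[p]tg_reprK -[q]tg_reprK /+%R /= !tgE.
exact/tg_classP/lrel_scaleDr.
Qed.

Fact tg_scalerDl p : {morph tg_scale^~ p : a b / a + b}.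
Proof.
move=> a b /=; rewrite -[p]tg_reprK -[RHS]/(tg_add _ _) !tgE.
exact/tg_classP/lrel_scaleDl.
Qed.

HB.instance Definition _ := GRing.Zmodule_isLmodule.Build K tilde_g
  tg_scalerA tg_scale1r tg_scalerDr tg_scalerDl.

Fact tg_lie_linearl (a : K) (u v w : tilde_g) :
  tg_lie (a *: u + v) w = a *: tg_lie u w + tg_lie v w.
Proof.
rewrite -[u]tg_reprK -[v]tg_reprK -[w]tg_reprK.
rewrite -[LHS]/(tg_lie (tg_add (tg_scale _ _) _) _).
rewrite -[RHS]/(tg_add (tg_scale _ _) _) !tgE; exact/tg_classP/lrel_linearl.
Qed.

Fact tg_lie_linearr (a : K) (u v w : tilde_g) :
  tg_lie w (a *: u + v) = a *: tg_lie w u + tg_lie w v.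
Proof.
rewrite -[u]tg_reprK -[v]tg_reprK -[w]tg_reprK.
rewrite -[LHS]/(tg_lie _ (tg_add (tg_scale _ _) _)).
rewrite -[RHS]/(tg_add (tg_scale _ _) _) !tgE; exact/tg_classP/lrel_linearr.
Qed.

Fact tg_liexx (u : tilde_g) : tg_lie u u = 0.
Proof. by rewrite -[u]tg_reprK tgE; apply/tg_classP/lrel_liexx. Qed.

Fact tg_lie_jacobi (u v w : tilde_g) :
  tg_lie u (tg_lie v w) + tg_lie v (tg_lie w u) + tg_lie w (tg_lie u v) = 0.
Proof.
rewrite -[u]tg_reprK -[v]tg_reprK -[w]tg_reprK.
rewrite -[LHS]/(tg_add (tg_add _ _) _) !tgE; exact/tg_classP/lrel_jacobi.
Qed.

HB.instance Definition _ := Lmodule_isLieAlgebra.Build K tilde_g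
  tg_lie_linearl tg_lie_linearr tg_liexx tg_lie_jacobi.

Definition tg_h (i : 'I_n) : tilde_g := tg_class (TH i).
Definition tg_x (i : 'I_n) : tilde_g := tg_class (TX i).
Definition tg_y (i : 'I_n) : tilde_g := tg_class (TY i).

(* [tg_homog d] is the component of degree [d] of the grading of [tilde_g] by
   Z^n. *)
Inductive tg_homog : 'rV[int]_n -> tilde_g -> Prop :=
| tg_homog_h i : tg_homog 0 (tg_h i)
| tg_homog_x i : tg_homog (delta_mx 0 i) (tg_x i)
| tg_homog_y i : tg_homog (- delta_mx 0 i) (tg_y i)
| tg_homog_lie d e u v :
    tg_homog d u -> tg_homog e v -> tg_homog (d + e) (lie u v)
| tg_homog0 d : tg_homog d 0
| tg_homog_lin d a u v :
    tg_homog d u -> tg_homog d v -> tg_homog d (a *: u + v).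

Definition tg_ideal (I : tilde_g -> Prop) : Prop :=
  [/\ I 0,
      forall (a : K) u v, I u -> I v -> I (a *: u + v) &
      forall u v, I v -> I (lie u v)].

Definition tg_graded (I : tilde_g -> Prop) : Prop :=
  forall u, I u -> exists (m : nat) (d : 'I_m -> 'rV[int]_n) (w : 'I_m -> tilde_g),
    (forall k, tg_homog (d k) (w k) /\ I (w k)) /\ u = \sum_k w k.

Definition tg_meets_h_trivially (I : tilde_g -> Prop) : Prop :=
  forall c : 'I_n -> K,
    I (\sum_i c i *: tg_h i) -> \sum_i c i *: tg_h i = 0.

(* The sum of all the graded ideals that meet Span(h_i) trivially. It is itself
   such an ideal, hence the largest one: the component of degree 0 of [tilde_g]
   is Span(h_i), and each summand has zero intersection with it. *)
Inductive tg_max_ideal : tilde_g -> Prop :=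
| tg_max_ideal_in I u :
    tg_ideal I -> tg_graded I -> tg_meets_h_trivially I -> I u -> tg_max_ideal u
| tg_max_ideal0 : tg_max_ideal 0
| tg_max_idealD u v : tg_max_ideal u -> tg_max_ideal v -> tg_max_ideal (u + v).

Definition tg_max : {pred tilde_g} := fun u => `[< tg_max_ideal u >].

Fact tg_max_submod : submod_closed tg_max.
Proof.
split=> [|a u v /asboolP mu /asboolP mv]; first exact/asboolP/tg_max_ideal0.
apply/asboolP/tg_max_idealD => {v mv}//; elim: mu => [I w idI gI tI Iw||].
- apply: (tg_max_ideal_in idI gI tI); case: idI => I0 Il _.
  by rewrite -[_ *: _]addr0; apply: Il.
- by rewrite scaler0; apply: tg_max_ideal0.
- by move=> v w _ mv _ mw; rewrite scalerDr; apply: tg_max_idealD.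
Qed.

Fact tg_max_lie u v : v \in tg_max -> lie u v \in tg_max.
Proof.
move=> /asboolP mv; apply/asboolP; elim: mv => [I w idI gI tI Iw||].
- by apply: (tg_max_ideal_in idI gI tI); case: idI => _ _; apply.
- by rewrite lie0r; apply: tg_max_ideal0.
- by move=> w z _ mw _ mz; rewrite lieDr; apply: tg_max_idealD.
Qed.

HB.instance Definition _ :=
  GRing.isSubmodClosed.Build K tilde_g tg_max (GRing.submod_closed_semi tg_max_submod).

Definition gA := lmod_quot tg_max.

HB.instance Definition _ := GRing.Lmodule.on gA.

Definition gA_proj (u : tilde_g) : gA := @lmod_proj K tilde_g tg_max u.

Definition gA_lie (p q : gA) : gA :=
  gA_proj (lie (lmod_lift p) (lmod_lift q)).

Lemma gA_lieE u v : gA_lie (gA_proj u) (gA_proj v) = gA_proj (lie u v).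
Proof.
apply/lmod_projP.
set u' := lmod_lift _; set v' := lmod_lift _.
have -> : lie u' v' - lie u v = lie u' (v' - v) - lie v (u' - u).
  rewrite !lieDr -!scaleN1r !lieZr !scaleN1r opprD opprK.
  by rewrite [lie v u']lieC [lie v u]lieC opprK addrA addrNK.
by apply: rpredB; apply: tg_max_lie; apply: lmod_projK.
Qed.

Lemma gA_projE (a : K) u v :
  gA_proj (a *: u + v) = a *: gA_proj u + gA_proj v.
Proof. by rewrite /gA_proj lmod_projD lmod_projZ. Qed.

Lemma gA_surj (p : gA) : p = gA_proj (lmod_lift p).
Proof. by rewrite /gA_proj lmod_liftK. Qed.

Fact gA_lie_linearl (a : K) (u v w : gA) :
  gA_lie (a *: u + v) w = a *: gA_lie u w + gA_lie v w.
Proof.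
rewrite [u]gA_surj [v]gA_surj [w]gA_surj -gA_projE !gA_lieE -gA_projE.
by rewrite lie_linearl.
Qed.

Fact gA_lie_linearr (a : K) (u v w : gA) :
  gA_lie w (a *: u + v) = a *: gA_lie w u + gA_lie w v.
Proof.
rewrite [u]gA_surj [v]gA_surj [w]gA_surj -gA_projE !gA_lieE -gA_projE.
by rewrite lie_linearr.
Qed.

Fact gA_liexx (u : gA) : gA_lie u u = 0.
Proof. by rewrite [u]gA_surj gA_lieE liexx; apply: lmod_proj0. Qed.

Fact gA_lie_jacobi (u v w : gA) :
  gA_lie u (gA_lie v w) + gA_lie v (gA_lie w u) + gA_lie w (gA_lie u v) = 0.
Proof.
rewrite [u]gA_surj [v]gA_surj [w]gA_surj !gA_lieE -!lmod_projD lie_jacobi.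
exact: lmod_proj0.
Qed.

HB.instance Definition _ := Lmodule_isLieAlgebra.Build K gA
  gA_lie_linearl gA_lie_linearr gA_liexx gA_lie_jacobi.

Definition gA_h (i : 'I_n) : gA := gA_proj (tg_h i).
Definition gA_x (i : 'I_n) : gA := gA_proj (tg_x i).
Definition gA_y (i : 'I_n) : gA := gA_proj (tg_y i).

Inductive gA_pos : gA -> Prop :=
| gA_pos_x i : gA_pos (gA_x i)
| gA_pos_lie u v : gA_pos u -> gA_pos v -> gA_pos (lie u v)
| gA_pos0 : gA_pos 0
| gA_pos_lin a u v : gA_pos u -> gA_pos v -> gA_pos (a *: u + v).

End Presentation.

Definition is_basis (K : fieldType) (V : lmodType K) (S : V -> Prop) (m : nat)
    (b : m.-tuple V) : Prop :=
  (forall i, S (tnth b i)) /\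
  (forall u, S u -> exists! c : 'rV[K]_m, u = \sum_i c 0 i *: tnth b i).

Section Cohomology.
Variables (K : fieldType) (L : lieAlgType K).

Definition is_derivation (D : L -> L) : Prop :=
  linear D /\ forall u v, D (lie u v) = lie (D u) v + lie u (D v).

Definition derivation : {pred L -> L} := fun D => `[< is_derivation D >].

Fact derivation_submod : submod_closed derivation.
Proof.
split=> [|a D E /asboolP[Dl DL] /asboolP[El EL]]; apply/asboolP; split.
- by move=> a u v /=; rewrite scaler0 addr0.
- by move=> u v /=; rewrite lie0l lie0r addr0.
- move=> b u v; rewrite /= !fctE.
  by rewrite Dl El !scalerDr !scalerA [b * a]mulrC !addrA; congr (_ + _); rewrite addrAC.
- move=> u v; rewrite !fctE DL EL !lieDl !lieDr !lieZl !lieZr scalerDr.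
  by rewrite addrACA.
Qed.

HB.instance Definition _ :=
  GRing.isSubmodClosed.Build K (L -> L) derivation
    (GRing.submod_closed_semi derivation_submod).

Definition Der := {D : L -> L | D \in derivation}.
HB.instance Definition _ := SubType.on Der.
HB.instance Definition _ := Choice.on Der.
HB.instance Definition _ := [SubChoice_isSubLmodule of Der by <:].

Definition inner : {pred Der} :=
  fun D => `[< exists u : L, forall v, val D v = lie u v >].

Fact inner_submod : submod_closed inner.
Proof.
split=> [|a D E /asboolP[u uD] /asboolP[v vE]]; apply/asboolP.
- by exists 0 => v; rewrite raddf0 lie0l.
- by exists (a *: u + v) => w; rewrite linearP lieDl lieZl -uD -vE.
Qed.

HB.instance Definition _ :=
  GRing.isSubmodClosed.Build K Der inner (GRing.submod_closed_semi inner_submod).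

Definition H1_adj := lmod_quot inner.
HB.instance Definition _ := GRing.Lmodule.on H1_adj.

Definition cochain1 (f : L -> K^o) : Prop := linear f.

Definition cochain2 (w : L -> L -> K^o) : Prop :=
  [/\ forall u, linear (w u), forall v, linear (w^~ v) & forall u, w u u = 0].

(* (d f)(u_0, ..., u_k) = sum over i < j of (-1)^(i + j) times f evaluated at
   [u_i, u_j] followed by the other arguments in order, for k = 1 and k = 2. *)
Definition d1 (f : L -> K^o) : L -> L -> K^o := fun u v => - f (lie u v).

Definition d2 (w : L -> L -> K^o) : L -> L -> L -> K^o :=
  fun u v t => - w (lie u v) t + w (lie u t) v - w (lie v t) u.

Definition cocycle2 : {pred L -> L -> K^o} :=
  fun w => `[< cochain2 w /\ forall u v t, d2 w u v t = 0 >].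

Fact cocycle2_submod : submod_closed cocycle2.
Proof.
split=> [|a f g /asboolP[[fr fl fa] fd] /asboolP[[gr gl ga] gd]]; apply/asboolP.
  have E (b : K) : (0 : K^o) = b *: (0 : K^o) + 0 by rewrite scaler0 addr0.
  have E0 : - 0 + 0 - 0 = 0 :> K^o by rewrite oppr0 !addr0.
  split; last by move=> u v t; apply: E0.
  by split=> [u b v t|u b v t|u] //; apply: E.
split; first split.
- move=> u b v t /=; rewrite !fctE fr gr !scalerDr !scalerA [b * a]mulrC !addrA.
  by congr (_ + _); rewrite addrAC.
- move=> u b v t /=; rewrite !fctE (fl u b v t : f _ u = _).
  rewrite (gl u b v t : g _ u = _) !scalerDr !scalerA [b * a]mulrC !addrA.
  by congr (_ + _); rewrite addrAC.
- by move=> u; rewrite !fctE fa ga scaler0 addr0.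
- move=> u v t; transitivity (a *: d2 f u v t + d2 g u v t); last first.
    by rewrite fd gd scaler0 addr0.
  rewrite /d2 !fctE !scalerDr !scalerN !opprD.
  by rewrite [RHS]addrACA; congr (_ + _); rewrite [RHS]addrACA.
Qed.

HB.instance Definition _ :=
  GRing.isSubmodClosed.Build K (L -> L -> K^o) cocycle2
    (GRing.submod_closed_semi cocycle2_submod).

Definition Z2 := {w : L -> L -> K^o | w \in cocycle2}.
HB.instance Definition _ := SubType.on Z2.
HB.instance Definition _ := Choice.on Z2.
HB.instance Definition _ := [SubChoice_isSubLmodule of Z2 by <:].

Definition B2 : {pred Z2} :=
  fun w => `[< exists2 f, cochain1 f & val w = d1 f >].

Fact B2_submod : submod_closed B2.
Proof.
split=> [|a f g /asboolP[p pl fE] /asboolP[q ql gE]]; apply/asboolP.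
- exists (fun=> 0) => [b u v|]; first by rewrite scaler0 addr0.
  by apply/funext => u; apply/funext => v; rewrite raddf0 /d1 oppr0.
- exists (a *: p + q) => [b u v|].
  + rewrite !fctE pl ql !scalerDr !scalerA [b * a]mulrC !addrA.
    by congr (_ + _); rewrite addrAC.
  + have -> : val (a *: f + g) = a *: val f + val g by [].
    rewrite fE gE; apply/funext => u; apply/funext => v.
    by rewrite /d1 !fctE opprD scalerN.
Qed.

HB.instance Definition _ :=
  GRing.isSubmodClosed.Build K Z2 B2 (GRing.submod_closed_semi B2_submod).

Definition H2_triv := lmod_quot B2.
HB.instance Definition _ := GRing.Lmodule.on H2_triv.

End Cohomology.

Definition br2_cartan (K : fieldType) (eps : K) : 'M[K]_2 :=
  \matrix_(i, j) nth 0 (nth [::] [:: [:: 2; -1]; [:: -2; 1 - eps]] i) j.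

Lemma br2_cartan_unit (K : fieldType) (eps : K) :
  3%N \in [pchar K] -> eps != 0 -> br2_cartan eps \in unitmx.
Proof.
move=> char3 eps0; rewrite unitmxE unitfE.
have -> : \det (br2_cartan eps) = - (2 * eps).
  rewrite (expand_det_row _ 0) !big_ord_recl big_ord0 /cofactor !det_mx11 !mxE /=.
  rewrite expr0 expr1 mul1r mulrBr mulr1 addr0 mulN1r mulN1r !opprK.
  by rewrite addrAC subrr add0r.
by rewrite oppr_eq0 mulf_neq0 // -(dvdn_pcharf char3).
Qed.

Definition br2 (K : fieldType) (eps : K) := gA (br2_cartan eps).
HB.instance Definition _ (K : fieldType) (eps : K) := LieAlgebra.on (br2 eps).

Definition br2_x1 (K : fieldType) (eps : K) : br2 eps := gA_x (br2_cartan eps) 0.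
Definition br2_x2 (K : fieldType) (eps : K) : br2 eps := gA_x (br2_cartan eps) 1.
Definition br2_x3 (K : fieldType) (eps : K) : br2 eps :=
  lie (br2_x1 eps) (br2_x2 eps).
Definition br2_x4 (K : fieldType) (eps : K) : br2 eps :=
  - lie (br2_x2 eps) (lie (br2_x2 eps) (br2_x1 eps)).

(* Main.v *)
(** The algebra [br(2; eps)] has the roots ±(1,0), ±(0,1), ±(1,1), ±(1,2), and is
    realised on [K^10] by explicit structure constants.  Evaluating the
    presentation there gives [phi : tilde_g -> K^10], whose kernel is the maximal
    graded ideal: it is graded because [phi] has a graded section, and conversely
    a homogeneous element of a graded ideal meeting the torus trivially can be
    bracketed with a root vector of the opposite degree into the torus, which is
    the whole component of degree 0 of [tilde_g]; so its image is 0.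

    Modulo 3 the eight roots are exactly the nonzero vectors of F_3^2.  With
    [i^2 = -1], the element [h0 = d_1 + i d_2] of the torus therefore acts with
    the eight elements of F_9^* as pairwise distinct eigenvalues on the root
    vectors.  Subtracting an inner derivation (a coboundary) makes a derivation
    preserve the torus (a cocycle vanish on [h0]), hence respect weights; after a
    further correction by the torus it vanishes on the generators [x_i, y_i], and
    so everywhere, since the kernel of a derivation and the radical of a cocycle
    are subalgebras. *)
Require Import Defs.
From HB Require Import structures.
From mathcomp Require Import all_boot all_algebra zify ring boolp.
Import GRing.Theory.

Set Implicit Arguments.
Unset Strict Implicit.
Unset Printing Implicit Defensive.

Local Open Scope ring_scope.

(** * Brackets of finite sums *)

Section LieSum.
Variables (K : fieldType) (L : lieAlgType K) (I : Type) (r : seq I).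

Lemma lie_sumr (u : L) (F : I -> L) :
  lie u (\sum_(i <- r) F i) = \sum_(i <- r) lie u (F i).
Proof. by apply: (big_morph (lie u)) => [v w|]; rewrite ?lieDr ?lie0r. Qed.

Lemma lie_suml (u : L) (F : I -> L) :
  lie (\sum_(i <- r) F i) u = \sum_(i <- r) lie (F i) u.
Proof.
by apply: (big_morph (fun v => lie v u)) => [v w|]; rewrite ?lieDl ?lie0l.
Qed.

End LieSum.

(** * The universal property of [tilde_g] *)

Section Lift.
Variables (K : fieldType) (n : nat) (A : 'M[K]_n) (L : lieAlgType K).
Variables h x y : 'I_n -> L.

Fixpoint lterm_eval (t : lterm K n) : L :=
  match t with
  | TH i => h i
  | TX i => x i
  | TY i => y i
  | TZero => 0
  | TOpp t => - lterm_eval t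
  | TAdd t u => lterm_eval t + lterm_eval u
  | TScale a t => a *: lterm_eval t
  | TLie t u => lie (lterm_eval t) (lterm_eval u)
  end.

Definition tg_lift (p : tilde_g A) : L := lterm_eval (tg_repr p).

Hypothesis hh : forall i j, lie (h i) (h j) = 0.
Hypothesis hx : forall i j, lie (h i) (x j) = A i j *: x j.
Hypothesis hy : forall i j, lie (h i) (y j) = - A i j *: y j.
Hypothesis xy : forall i j, lie (x i) (y j) = if i == j then h i else 0.

(** Every rule of [lrel] is a closure rule of congruences, a Lie algebra axiom valid in [L], or one
    of the four relations assumed of [h], [x], [y]. Hence the representative chosen in [tg_lift] is
    immaterial. *)
Lemma lterm_eval_lrel t u : lrel A t u -> lterm_eval t = lterm_eval u.
Proof.
elim=> {t u} //=.
- by move=> t u v _ -> _ ->.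
- by move=> t t' _ ->.
- by move=> t t' u u' _ -> _ ->.
- by move=> a t t' _ ->.
- by move=> t t' u u' _ -> _ ->.
- by move=> t u v; rewrite addrA.
- by move=> t u; rewrite addrC.
- by move=> t; rewrite add0r.
- by move=> t; rewrite addNr.
- by move=> a b t; rewrite scalerA.
- by move=> t; rewrite scale1r.
- by move=> a t u; rewrite scalerDr.
- by move=> a b t; rewrite scalerDl.
- by move=> a t u v; rewrite lie_linearl.
- by move=> a t u v; rewrite lie_linearr.
- by move=> t; rewrite liexx.
- by move=> t u v; rewrite lie_jacobi.
- by move=> i j; rewrite xy; case: eqP.
Qed.

Lemma tg_lift_class t : tg_lift (tg_class A t) = lterm_eval t.
Proof. exact/lterm_eval_lrel/tg_classK. Qed.

Lemma tg_lift_linear : linear tg_lift.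
Proof.
move=> a u v; rewrite -[u]tg_reprK -[v]tg_reprK.
rewrite -[_ + _]/(tg_add (tg_scale _ _) _) tg_scaleE tg_addE.
by rewrite !tg_lift_class.
Qed.

Lemma tg_lift_lie u v : tg_lift (lie u v) = lie (tg_lift u) (tg_lift v).
Proof.
rewrite -[u]tg_reprK -[v]tg_reprK.
by rewrite -[X in tg_lift X]/(tg_lie _ _) tg_lieE !tg_lift_class.
Qed.

Lemma tg_lift_h i : tg_lift (tg_h A i) = h i.
Proof. exact: tg_lift_class. Qed.

Lemma tg_lift_x i : tg_lift (tg_x A i) = x i.
Proof. exact: tg_lift_class. Qed.

Lemma tg_lift_y i : tg_lift (tg_y A i) = y i.
Proof. exact: tg_lift_class. Qed.

End Lift.

(** * The principal grading of [tilde_g] and its component of degree 0 *)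

Section Triangular.
Variables (K : fieldType) (n : nat) (A : 'M[K]_n).
Local Notation h := (tg_h A).
Local Notation x := (tg_x A).
Local Notation y := (tg_y A).

Lemma tg_hh i j : lie (h i) (h j) = 0.
Proof. by rewrite -[LHS]/(tg_lie _ _) tg_lieE; apply/tg_classP/lrel_HH. Qed.

Lemma tg_hx i j : lie (h i) (x j) = A i j *: x j.
Proof.
rewrite -[LHS]/(tg_lie _ _) -[RHS]/(tg_scale _ _) tg_lieE tg_scaleE.
exact/tg_classP/lrel_HX.
Qed.

Lemma tg_hy i j : lie (h i) (y j) = - A i j *: y j.
Proof.
rewrite -[LHS]/(tg_lie _ _) -[RHS]/(tg_scale _ _) tg_lieE tg_scaleE.
exact/tg_classP/lrel_HY.
Qed.

Lemma tg_xy i j : lie (x i) (y j) = if i == j then h i else 0.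
Proof.
rewrite -[LHS]/(tg_lie _ _) tg_lieE.
rewrite (_ : (if _ then _ else _) = tg_class A (if i == j then TH i else TZero)).
  exact/tg_classP/lrel_XY.
by case: eqP.
Qed.

(** The torus is covered because h_i = [x_i, y_i]. *)
Lemma tg_generated (P : tilde_g A -> Prop) :
    P 0 -> (forall a u v, P u -> P v -> P (a *: u + v)) ->
    (forall u v, P u -> P v -> P (lie u v)) ->
    (forall i, P (x i)) -> (forall i, P (y i)) ->
  forall u, P u.
Proof.
move=> P0 Plin Plie Px Py u; rewrite -[u]tg_reprK.
have PZ a v : P v -> P (a *: v) by move=> Pv; rewrite -[_ *: _]addr0; apply: Plin.
elim: (tg_repr u) => [i|i|i||t Pt|t Pt t' Pt'|a t Pt|t Pt t' Pt'] //.
- by have := Plie _ _ (Px i) (Py i); rewrite tg_xy eqxx.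
- exact: Px.
- exact: Py.
- rewrite -tg_oppE -[tg_opp _]/(- (tg_class A t : tilde_g A)) -scaleN1r.
  exact: PZ.
- rewrite -tg_addE -[tg_add _ _]/((tg_class A t : tilde_g A) + _).
  by rewrite -[X in X + _]scale1r; apply: Plin.
- by rewrite -tg_scaleE; apply: PZ.
- by rewrite -tg_lieE; apply: Plie.
Qed.

(* The principal grading, with each component of nonzero degree spanned by
   left-normed brackets of the [x_i] alone or of the [y_i] alone. *)
Inductive tg_tri : int -> tilde_g A -> Prop :=
| tg_tri_h i : tg_tri 0 (h i)
| tg_tri_x i : tg_tri 1 (x i)
| tg_tri_y i : tg_tri (Negz 0) (y i)
| tg_tri_adx m i u : tg_tri (Posz m.+1) u -> tg_tri (Posz m.+2) (lie (x i) u)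
| tg_tri_ady m i u : tg_tri (Negz m) u -> tg_tri (Negz m.+1) (lie (y i) u)
| tg_tri0 d : tg_tri d 0
| tg_tri_lin d a u v : tg_tri d u -> tg_tri d v -> tg_tri d (a *: u + v).

Lemma tg_triD d u v : tg_tri d u -> tg_tri d v -> tg_tri d (u + v).
Proof. by move=> du dv; rewrite -[u]scale1r; apply: tg_tri_lin. Qed.

Lemma tg_triZ d a u : tg_tri d u -> tg_tri d (a *: u).
Proof.
by move=> du; rewrite -[_ *: _]addr0; apply: tg_tri_lin => //; apply: tg_tri0.
Qed.

Lemma tg_triN d u : tg_tri d u -> tg_tri d (- u).
Proof. by rewrite -scaleN1r; apply: tg_triZ. Qed.

(** The bracket rules of [tg_tri] never land in degree 0, so only the h_i and their combinations
    occur there. *)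
Lemma tg_tri_degree0 u : tg_tri 0 u -> exists c, u = \sum_i c i *: h i.
Proof.
move Ed: (0 : int) => d du; elim: du Ed => // {d u}.
- move=> i _; exists (fun j => (j == i)%:R).
  rewrite (bigD1 i) //= eqxx scale1r big1 ?addr0 // => j /negPf->.
  by rewrite scale0r.
- by move=> e _; exists (fun=> 0); rewrite big1 // => i _; rewrite scale0r.
- move=> e a v w _ IHv _ IHw d0.
  have [c ->] := IHv d0; have [c' ->] := IHw d0.
  exists (fun i => a * c i + c' i); rewrite scaler_sumr -big_split /=.
  by apply: eq_bigr => i _; rewrite scalerDl scalerA.
Qed.

Lemma tg_tri_ad_h i d u : tg_tri d u -> tg_tri d (lie (h i) u).
Proof.
elim=> {d u} [j|j|j|m j u du IH|m j u du IH|d|d a u v _ IHu _ IHv].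
- by rewrite tg_hh; apply: tg_tri0.
- by rewrite tg_hx; apply/tg_triZ/tg_tri_x.
- by rewrite tg_hy; apply/tg_triZ/tg_tri_y.
- rewrite lie_leibniz tg_hx lieZl.
  by apply: tg_tri_lin; apply: tg_tri_adx.
- rewrite lie_leibniz tg_hy lieZl.
  by apply: tg_tri_lin; apply: tg_tri_ady.
- by rewrite lie0r; apply: tg_tri0.
- by rewrite lie_linearr; apply: tg_tri_lin.
Qed.

Lemma tg_tri_sum (I : finType) d (F : I -> tilde_g A) :
  (forall i, tg_tri d (F i)) -> tg_tri d (\sum_i F i).
Proof.
move=> dF; elim/big_ind: _ => // [|u v]; [exact: tg_tri0 | exact: tg_triD].
Qed.

(** By Leibniz, x_i passes through the letters of a word in the y_j, leaving a torus term [h_i, u]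
    whenever it meets y_i. *)
Lemma tg_tri_ad_x i d u : tg_tri d u -> tg_tri (1 + d) (lie (x i) u).
Proof.
have x_h v : tg_tri 0 v -> tg_tri 1 (lie (x i) v).
  case/tg_tri_degree0=> c ->; rewrite lie_sumr; apply: tg_tri_sum => j.
  by rewrite lieZr lieC tg_hx; apply/tg_triZ/tg_triN/tg_triZ/tg_tri_x.
elim=> {d u} [j|j|j|m j u du IH|m j u du IH|d|d a u v _ IHu _ IHv].
- exact/x_h/tg_tri_h.
- exact/tg_tri_adx/tg_tri_x.
- by rewrite tg_xy; case: eqP => _; [apply: tg_tri_h | apply: tg_tri0].
- exact/tg_tri_adx/tg_tri_adx.
- rewrite (_ : 1 + _ = Negz m); last by lia.
  rewrite lie_leibniz tg_xy; apply: tg_triD.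
    by case: eqP => _; [apply: tg_tri_ad_h | rewrite lie0l; apply: tg_tri0].
  (* For m = 0 the element [x_i, u] has degree 0, where [tg_tri_ady] does not apply. It is therefore
     expanded in the h_k, and each [y_j, h_k] is a multiple of y_j. *)
  case: m => [|m] in du IH *; last first.
    by apply: tg_tri_ady; rewrite (_ : Negz m = 1 + Negz m.+1) //; lia.
  have [c ->] := tg_tri_degree0 IH; rewrite lie_sumr; apply: tg_tri_sum => k.
  by rewrite lieZr lieC tg_hy; apply/tg_triZ/tg_triN/tg_triZ/tg_tri_y.
- by rewrite lie0r; apply: tg_tri0.
- by rewrite lie_linearr; apply: tg_tri_lin.
Qed.

Lemma tg_tri_ad_y i d u : tg_tri d u -> tg_tri (-1 + d) (lie (y i) u).
Proof.
have y_h v : tg_tri 0 v -> tg_tri (Negz 0) (lie (y i) v).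
  case/tg_tri_degree0=> c ->; rewrite lie_sumr; apply: tg_tri_sum => j.
  by rewrite lieZr lieC tg_hy; apply/tg_triZ/tg_triN/tg_triZ/tg_tri_y.
elim=> {d u} [j|j|j|m j u du IH|m j u du IH|d|d a u v _ IHu _ IHv].
- exact/y_h/tg_tri_h.
- rewrite lieC tg_xy; apply: tg_triN.
  by case: eqP => _; [apply: tg_tri_h | apply: tg_tri0].
- exact/tg_tri_ady/tg_tri_y.
- rewrite (_ : -1 + _ = Posz m.+1) //.
  rewrite lie_leibniz [lie (y i) _]lieC tg_xy; apply: tg_triD.
    case: eqP => _; last by rewrite oppr0 lie0l; apply: tg_tri0.
    by rewrite -scaleN1r lieZl; apply/tg_triZ/tg_tri_ad_h.
  case: m => [|m] in du IH *; last first.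
    exact: (@tg_tri_adx m j _ IH).
  have [c ->] := tg_tri_degree0 IH; rewrite lie_sumr; apply: tg_tri_sum => k.
  by rewrite lieZr lieC tg_hx; apply/tg_triZ/tg_triN/tg_triZ/tg_tri_x.
- rewrite (_ : -1 + _ = Negz m.+2) //.
  exact/tg_tri_ady/tg_tri_ady.
- by rewrite lie0r; apply: tg_tri0.
- by rewrite lie_linearr; apply: tg_tri_lin.
Qed.

Definition row_height (d : 'rV[int]_n) : int := \sum_i d 0 i.

Lemma row_heightD d e : row_height (d + e) = row_height d + row_height e.
Proof. by rewrite -big_split; apply: eq_bigr => i _; rewrite mxE. Qed.

Lemma row_height0 : row_height 0 = 0.
Proof. by rewrite /row_height big1 // => i _; rewrite mxE. Qed.

Lemma row_height_delta i : row_height (delta_mx 0 i) = 1.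
Proof.
rewrite /row_height (bigD1 i) //= big1 ?mxE ?eqxx ?addr0 // => j /negPf ji.
by rewrite mxE ji andbF.
Qed.

Lemma row_height_Ndelta i : row_height (- delta_mx 0 i) = -1.
Proof.
apply: (addrI (1 : int)).
by rewrite -{1}(row_height_delta i) -row_heightD subrr row_height0.
Qed.

(** The ad of a bracket is the commutator of the ads, so the claim propagates from the generators.
    Quantifying over all [v] lets the two ads be applied in succession. *)
Lemma tg_homog_ad_tri d u :
  tg_homog d u -> forall e v, tg_tri e v -> tg_tri (row_height d + e) (lie u v).
Proof.
elim=> {d u} [i|i|i|d d' u u' _ IH _ IH'|d|d a u u' _ IH _ IH'] e v ev.
- by rewrite row_height0 add0r; apply: tg_tri_ad_h.
- by rewrite row_height_delta; apply: tg_tri_ad_x.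
- by rewrite row_height_Ndelta; apply: tg_tri_ad_y.
- rewrite (_ : lie _ v = lie u (lie u' v) - lie u' (lie u v)); last first.
    by rewrite [lie u (lie u' v)]lie_leibniz addrK.
  rewrite row_heightD; apply: tg_triD.
    by rewrite -addrA; apply/IH/IH'.
  by rewrite [row_height d + _]addrC -addrA; apply/tg_triN/IH'/IH.
- by rewrite lie0l; apply: tg_tri0.
- by rewrite lie_linearl; apply: tg_tri_lin; [apply: IH | apply: IH'].
Qed.

Lemma tg_homog_tri d u : tg_homog d u -> tg_tri (row_height d) u.
Proof.
elim=> {d u} [i|i|i|d d' u u' du _ _ IH'|d|d a u u' _ IH _ IH'].
- by rewrite row_height0; apply: tg_tri_h.
- by rewrite row_height_delta; apply: tg_tri_x.
- by rewrite row_height_Ndelta; apply: tg_tri_y.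
- by rewrite row_heightD; apply: tg_homog_ad_tri.
- exact: tg_tri0.
- exact: tg_tri_lin.
Qed.

(** This controls graded ideals: their elements of degree 0 lie in Span(h_i), where the trivial
    intersection forces them to vanish. *)
Lemma tg_homog_degree0 u : tg_homog 0 u -> exists c, u = \sum_i c i *: h i.
Proof. by move/tg_homog_tri; rewrite row_height0 => /tg_tri_degree0. Qed.

(** Sums of homogeneous elements contain the generators and are closed under brackets. Degrees may
    repeat in [s], as [tg_graded] allows. *)
Lemma tg_homog_decomp u : exists2 s : seq ('rV[int]_n * tilde_g A),
  forall p, p \in s -> tg_homog p.1 p.2 & u = \sum_(p <- s) p.2.
Proof.
elim/tg_generated: u => [|a u v [s sP ->] [s' sP' ->]|u v [s sP ->] [s' sP' ->]|i|i].
- by exists [::]; rewrite ?big_nil.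
- exists ([seq (p.1, a *: p.2) | p <- s] ++ s').
    move=> p; rewrite mem_cat => /orP[/mapP[q qs ->]|/sP'//].
    rewrite /= -[_ *: _]addr0; apply: tg_homog_lin; first exact: sP.
    exact: tg_homog0.
  by rewrite big_cat big_map scaler_sumr.
- exists [seq (p.1 + q.1, lie p.2 q.2) | p <- s, q <- s'].
    by move=> p /allpairsP[[q r] /= [qs rs ->]]; apply: tg_homog_lie; auto.
  rewrite big_allpairs_dep lie_suml; apply: eq_bigr => p _ /=.
  by rewrite lie_sumr.
- exists [:: (delta_mx 0 i, x i)]; last by rewrite big_seq1.
  by move=> p /[!inE]/eqP->; apply: tg_homog_x.
- exists [:: (- delta_mx 0 i, y i)]; last by rewrite big_seq1.
  by move=> p /[!inE]/eqP->; apply: tg_homog_y.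
Qed.

End Triangular.

(** * Coordinates on K^10 *)

Definition co (K : fieldType) (v : 'rV[K]_10) (k : nat) : K := v 0 (inord k).

Section Coordinates.
Variable K : fieldType.
Implicit Types u v : 'rV[K]_10.

Lemma co_row (f : nat -> K) k : (k < 10)%N -> co (\row_l f l) k = f k.
Proof. by move=> k10; rewrite /co mxE inordK. Qed.

Lemma coP u v : (forall k, (k < 10)%N -> co u k = co v k) <-> u = v.
Proof.
split=> [uv|->//]; apply/rowP => i.
by have := uv i (ltn_ord i); rewrite /co inord_val.
Qed.

Lemma co0 k : co (0 : 'rV[K]_10) k = 0. Proof. by rewrite /co mxE. Qed.
Lemma coD u v k : co (u + v) k = co u k + co v k. Proof. by rewrite /co mxE. Qed.
Lemma coN u k : co (- u) k = - co u k. Proof. by rewrite /co mxE. Qed.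
Lemma coZ a u k : co (a *: u) k = a * co u k. Proof. by rewrite /co mxE. Qed.

Definition cvec (i : nat) : 'rV[K]_10 := \row_(l < 10) (l == i :> nat)%:R.

Lemma co_cvec i k : (k < 10)%N -> co (cvec i) k = (k == i)%:R.
Proof. exact: (co_row (fun l => (l == i)%:R)). Qed.

Lemma co_sum v : v = \sum_(i < 10) co v i *: cvec i.
Proof.
apply/rowP => j; rewrite summxE (bigD1 j) //= big1 => [|i /negPf ij].
  by rewrite !mxE eqxx mulr1 addr0 /co inord_val.
by rewrite !mxE [_ == _ :> nat]eq_sym val_eqE ij mulr0.
Qed.

End Coordinates.

(** * The ten-dimensional model: structure constants and the Jacobi identity *)

Definition minor2 (K : fieldType) (u v : 'rV[K]_10) (i j : nat) : K :=
  co u i * co v j - co u j * co v i.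

(** The 3x3 minor, expanded along [u]. The Jacobi sum of an alternating bracket is alternating and
    trilinear, so its coordinates are combinations of such minors. *)
Definition minor3 (K : fieldType) (u v w : 'rV[K]_10) (i j k : nat) : K :=
  co u i * minor2 v w j k - co u j * minor2 v w i k + co u k * minor2 v w i j.

(* The positions 0, ..., 9 hold the coordinates along d_1, d_2, x_1, ..., x_4,
   y_1, ..., y_4, where (d_1, d_2) is the basis of the torus dual to the simple
   roots, y_3 = [y_1, y_2] and y_4 = [y_2, y_3]. *)
Definition br2_root (k : nat) : int * int :=
  nth (0, 0) [:: (0, 0); (0, 0); (1, 0); (0, 1); (1, 1); (1, 2);
                 (-1, 0); (0, -1); (-1, -1); (-1, -2)] k.

(* An entry (c, i, j) in position k means that [e_i, e_j] has the coordinate c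
   along e_k. *)
Definition br2_table (K : fieldType) (eps : K) : seq (seq (K * nat * nat)) :=
  let e (c : K) (i j : nat) := (c, i, j) in
  [:: [:: e 2 2 6; e 1 3 7; e 1 4 8];
      [:: e (-1) 2 6; e (- (2 + eps)) 3 7; e (1 + eps) 4 8; e (eps ^+ 2) 5 9];
      [:: e 1 0 2; e (-1) 4 7];
      [:: e 1 1 3; e (-1) 4 6; e (- eps) 5 8];
      [:: e 1 0 4; e 1 1 4; e 1 2 3; e (- eps) 5 7];
      [:: e 1 0 5; e 2 1 5; e 1 3 4];
      [:: e (-1) 0 6; e 1 3 8];
      [:: e (-1) 1 7; e 1 2 8; e eps 4 9];
      [:: e (-1) 0 8; e (-1) 1 8; e 1 6 7; e eps 3 9];
      [:: e (-1) 0 9; e (-2) 1 9; e 1 7 8]].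

Definition br2_bracket (K : fieldType) (eps : K) (u v : 'rV[K]_10) : 'rV[K]_10 :=
  \row_(k < 10) \sum_(t <- nth [::] (br2_table eps) k)
    t.1.1 * minor2 u v t.1.2 t.2.

(* [char3] is a parameter of the type because Jacobi holds only modulo 3. *)
Definition br2_model (K : fieldType) (char3 : 3%N \in [pchar K]) (eps : K) : Type :=
  'rV[K]_10.

Section Model.
Variables (K : fieldType) (char3 : 3%N \in [pchar K]) (eps : K).
Local Notation M := (br2_model char3 eps).
Local Notation bracket := (br2_bracket eps).

HB.instance Definition _ := GRing.Lmodule.on M.

Lemma co_bracket (u v : 'rV[K]_10) k : (k < 10)%N ->
  co (bracket u v) k = \sum_(t <- nth [::] (br2_table eps) k)
    t.1.1 * minor2 u v t.1.2 t.2.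
Proof.
exact: (co_row (fun k => \sum_(t <- nth [::] (br2_table eps) k)
    t.1.1 * minor2 u v t.1.2 t.2)).
Qed.

Fact br2_bracket_linearl (a : K) (u v w : M) :
  bracket (a *: u + v) w = a *: bracket u w + bracket v w.
Proof.
apply/coP => k k10; rewrite coD coZ !co_bracket // mulr_sumr -big_split /=.
by apply: eq_bigr => t _; rewrite /minor2 !coD !coZ; ring.
Qed.

Fact br2_bracket_linearr (a : K) (u v w : M) :
  bracket w (a *: u + v) = a *: bracket w u + bracket w v.
Proof.
apply/coP => k k10; rewrite coD coZ !co_bracket // mulr_sumr -big_split /=.
by apply: eq_bigr => t _; rewrite /minor2 !coD !coZ; ring.
Qed.

Fact br2_bracketxx (u : M) : bracket u u = 0.
Proof.
apply/coP => k k10; rewrite co0 co_bracket // big1 // => t _.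
by rewrite /minor2; ring.
Qed.

Section Coordinates.
Variables u v : 'rV[K]_10.
Local Notation m i j := (minor2 u v i%N j%N).

Lemma co_bracketE :
 ((co (bracket u v) 0 = (2 * m 2 6 + m 3 7 + m 4 8)%R) *
  (co (bracket u v) 1 = (- m 2 6 - (2 + eps) * m 3 7 + (1 + eps) * m 4 8
                         + eps ^+ 2 * m 5 9)%R) *
  (co (bracket u v) 2 = (m 0 2 - m 4 7)%R) *
  (co (bracket u v) 3 = (m 1 3 - m 4 6 - eps * m 5 8)%R) *
  (co (bracket u v) 4 = (m 0 4 + m 1 4 + m 2 3 - eps * m 5 7)%R) *
  (co (bracket u v) 5 = (m 0 5 + 2 * m 1 5 + m 3 4)%R) *
  (co (bracket u v) 6 = (- m 0 6 + m 3 8)%R) *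
  (co (bracket u v) 7 = (- m 1 7 + m 2 8 + eps * m 4 9)%R) *
  (co (bracket u v) 8 = (- m 0 8 - m 1 8 + m 6 7 + eps * m 3 9)%R) *
  (co (bracket u v) 9 = (- m 0 9 - 2 * m 1 9 + m 7 8)%R))%type.
Proof.
have E k : (k < 10)%N -> co (bracket u v) k =
    \sum_(t <- nth [::] (br2_table eps) k) t.1.1 * m t.1.2 t.2.
  exact: co_bracket.
by do !split; rewrite E //= !big_cons big_nil /=; ring.
Qed.

End Coordinates.

Lemma three_eq0 : 3 = 0 :> K.
Proof. by apply: pcharf0. Qed.

Fact br2_bracket_jacobi (u v w : M) :
  bracket u (bracket v w) + bracket v (bracket w u) + bracket w (bracket u v) = 0.
Proof.
have mod3 q a : a = 3 * q -> a = 0 :> K by rewrite three_eq0 mul0r.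
apply/coP; do 10?[case=> [_|]]; last by [].
all: rewrite !coD co0 !co_bracketE /minor2 !co_bracketE /minor2.
all: try ring.
(* The three coordinates in which the Jacobi sum is not 0 over the integers. *)
- apply: (mod3 (eps * (1 + eps) * (minor3 u v w 5 7 8 - minor3 u v w 3 4 9))).
  by rewrite /minor3 /minor2; ring.
- apply: (mod3 ((1 + eps) * (minor3 u v w 4 5 8 - minor3 u v w 3 5 7))).
  by rewrite /minor3 /minor2; ring.
- apply: (mod3 ((1 + eps) * (minor3 u v w 4 8 9 - minor3 u v w 3 7 9))).
  by rewrite /minor3 /minor2; ring.
Qed.

HB.instance Definition _ := Lmodule_isLieAlgebra.Build K M
  br2_bracket_linearl br2_bracket_linearr br2_bracketxx br2_bracket_jacobi.

End Model.

(** The bracket adds roots, which is read off the finite table. *)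
Lemma br2_table_root (K : fieldType) (eps : K) k : (k < 10)%N ->
  all (fun t => [&& (t.1.2 < 10)%N, (t.2 < 10)%N
                 & br2_root t.1.2 + br2_root t.2 == br2_root k])
      (nth [::] (br2_table eps) k).
Proof. by do 10?[case: k => [|k] //]. Qed.

(** * Evaluation of the presentation in the model *)

Section Identification.
Variables (K : fieldType) (char3 : 3%N \in [pchar K]) (eps : K).
Hypothesis eps_neq0 : eps != 0.
Local Notation M := (br2_model char3 eps).
Local Notation A := (br2_cartan eps).

Lemma co_lie (u v : M) k : co (lie u v) k = co (br2_bracket eps u v) k.
Proof. by []. Qed.

(** Since d_1, d_2 are dual to the simple roots, they act on a root vector by the two coordinates of
    its root. *)
Lemma co_lie_torus (a b : K) (v : M) k : (k < 10)%N ->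
  co (lie (a *: (cvec K 0 : M) + b *: (cvec K 1 : M)) v) k
  = (a * (br2_root k).1%:~R + b * (br2_root k).2%:~R) * co v k.
Proof.
move=> k10; rewrite co_lie; do 10?[case: k k10 => [|k] k10 //].
all: by rewrite co_bracketE /minor2 !coD !coZ !co_cvec //=; ring.
Qed.

(** The coordinates along d_1, d_2 are the values of the simple roots on h_i, that is, row [i] of
    the Cartan matrix. *)
Definition br2_model_h (i : 'I_2) : M :=
  A i 0 *: (cvec K 0 : M) + A i 1 *: (cvec K 1 : M).
Definition br2_model_x (i : 'I_2) : M := cvec K (2 + i).
Definition br2_model_y (i : 'I_2) : M := cvec K (6 + i).

Lemma ord2P (P : 'I_2 -> Prop) : P 0 -> P 1 -> forall i, P i.
Proof.
move=> P0 P1 [[|[|i]] i2] //.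
- by rewrite (_ : Ordinal i2 = 0) //; apply: val_inj.
- by rewrite (_ : Ordinal i2 = 1) //; apply: val_inj.
Qed.

Lemma br2_model_hh i j : lie (br2_model_h i) (br2_model_h j) = 0.
Proof.
apply/coP => k k10; rewrite co_lie_torus // co0 coD !coZ !co_cvec //.
by case: k k10 => [|[|k]] k10; rewrite ?mulr0 ?addr0 //; ring.
Qed.

Lemma br2_model_hx i j : lie (br2_model_h i) (br2_model_x j) = A i j *: br2_model_x j.
Proof.
apply/coP => k k10; rewrite co_lie_torus // coZ !co_cvec //.
case: eqP => [->|]; last by rewrite !mulr0.
by elim/ord2P: j; rewrite /= mulr1z mulr0z !mulr1 mulr0 ?addr0 ?add0r.
Qed.

Lemma br2_model_hy i j : lie (br2_model_h i) (br2_model_y j) = - A i j *: br2_model_y j.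
Proof.
apply/coP => k k10; rewrite co_lie_torus // coZ !co_cvec //.
case: eqP => [->|]; last by rewrite !mulr0.
by elim/ord2P: j; rewrite /= mulrN1z mulr0z mulrN1 !mulr1 mulr0 ?addr0 ?add0r.
Qed.

Lemma br2_model_xy i j :
  lie (br2_model_x i) (br2_model_y j) = if i == j then br2_model_h i else 0.
Proof.
have E3 := three_eq0 char3.
(* The table holds the second row of the Cartan matrix as (1, -(2 + eps)), which agrees with (-2, 1
   - eps) modulo 3. *)
have neg2 : -2 = 1 :> K by rewrite -[-2]addr0 -E3; ring.
have two_eps : 1 - eps = - (2 + eps) by rewrite -[in LHS]neg2; ring.
apply/coP; do 10?[case=> [_|]]; last by [].
all: rewrite co_lie co_bracketE /minor2 !co_cvec //.
all: elim/ord2P: i; elim/ord2P: j; rewrite /= ?co0 ?coD ?coZ ?co_cvec ?mxE //=.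
all: by rewrite ?neg2 ?two_eps; ring.
Qed.

Definition br2_phi : tilde_g A -> M := tg_lift br2_model_h br2_model_x br2_model_y.

Lemma br2_phi_linear : linear br2_phi.
Proof.
exact: (tg_lift_linear br2_model_hh br2_model_hx br2_model_hy br2_model_xy).
Qed.

HB.instance Definition _ :=
  GRing.isLinear.Build K (tilde_g A) M _ br2_phi br2_phi_linear.

Lemma br2_phi_lie u v : br2_phi (lie u v) = lie (br2_phi u) (br2_phi v).
Proof.
exact: (tg_lift_lie br2_model_hh br2_model_hx br2_model_hy br2_model_xy).
Qed.

Lemma br2_phi_h i : br2_phi (tg_h A i) = br2_model_h i.
Proof.
exact: (tg_lift_h br2_model_hh br2_model_hx br2_model_hy br2_model_xy).
Qed.

Lemma br2_phi_x i : br2_phi (tg_x A i) = br2_model_x i.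
Proof.
exact: (tg_lift_x br2_model_hh br2_model_hx br2_model_hy br2_model_xy).
Qed.

Lemma br2_phi_y i : br2_phi (tg_y A i) = br2_model_y i.
Proof.
exact: (tg_lift_y br2_model_hh br2_model_hx br2_model_hy br2_model_xy).
Qed.

Definition br2_homog (d : 'rV[int]_2) (v : M) : Prop :=
  forall k, (k < 10)%N -> co v k != 0 -> (d 0 0, d 0 1) = br2_root k.

(** By [br2_table_root] a term of coordinate [k] pairs positions whose roots add up to root [k]; if
    [d + e] is another degree, one factor of each product is 0. *)
Lemma br2_homog_lie d e u v :
  br2_homog d u -> br2_homog e v -> br2_homog (d + e) (lie u v).
Proof.
move=> du ev k k10; rewrite co_lie co_bracket //.
have /allP tk := br2_table_root eps k10.
apply: contraNeq => dek; rewrite big1_seq // => t /andP[_ /tk/and3P[i10 j10 /eqP ijk]].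
have dij : ~ (d 0 0, d 0 1) + (e 0 0, e 0 1) = br2_root k.
  by move=> E; case/eqP: dek; rewrite -E !mxE.
have E i j : (i < 10)%N -> (j < 10)%N -> br2_root i + br2_root j = br2_root k ->
    co u i * co v j = 0.
  move=> {}i10 {}j10 {}ijk.
  have [->|/(du _ i10) di] := eqVneq (co u i) 0; first by rewrite mul0r.
  have [->|/(ev _ j10) ej] := eqVneq (co v j) 0; first by rewrite mulr0.
  by case: dij; rewrite di ej.
by rewrite /minor2 !E ?subr0 ?mulr0 // addrC.
Qed.

Lemma br2_homog_cvec (d : 'rV[int]_2) i :
  (d 0 0, d 0 1) = br2_root i -> br2_homog d (cvec K i).
Proof.
move=> di k k10; by rewrite co_cvec //; case: (k =P i) => [-> //|_]; rewrite eqxx.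
Qed.

Lemma br2_homog_lin d a u v :
  br2_homog d u -> br2_homog d v -> br2_homog d (a *: u + v).
Proof.
move=> du dv k k10; rewrite coD coZ.
have [->|/(du _ k10)//] := eqVneq (co u k) 0; rewrite mulr0 add0r; exact: dv.
Qed.

Lemma br2_homog0 d : br2_homog d 0.
Proof. by move=> k _; rewrite co0 eqxx. Qed.

Lemma br2_phi_homog d u : tg_homog d u -> br2_homog d (br2_phi u).
Proof.
elim=> {d u} [i|i|i|d e u v _ IHu _ IHv|d|d a u v _ IHu _ IHv].
- rewrite br2_phi_h; apply: br2_homog_lin; last rewrite -[_ *: _]addr0; last first.
    apply: br2_homog_lin; last exact: br2_homog0.
    by apply: br2_homog_cvec; rewrite !mxE.
  by apply: br2_homog_cvec; rewrite !mxE.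
- by rewrite br2_phi_x; apply: br2_homog_cvec; elim/ord2P: i; rewrite !mxE.
- by rewrite br2_phi_y; apply: br2_homog_cvec; elim/ord2P: i; rewrite !mxE.
- by rewrite br2_phi_lie; apply: br2_homog_lie.
- by rewrite raddf0; apply: br2_homog0.
- by rewrite linearP; apply: br2_homog_lin.
Qed.

(* In characteristic 3, h_0 + h_1 = - eps d_2 and d_1 = - h_0 - d_2. *)
Definition br2_lift (k : nat) : tilde_g A :=
  let h := tg_h A in let x := tg_x A in let y := tg_y A in
  let d2 := - eps^-1 *: (h 0 + h 1) in
  nth 0 [:: - h 0 - d2; d2;
            x 0; x 1; lie (x 0) (x 1); lie (x 1) (lie (x 0) (x 1));
            y 0; y 1; lie (y 0) (y 1); lie (y 1) (lie (y 0) (y 1))] k.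

Lemma br2_phi_lift k : (k < 10)%N -> br2_phi (br2_lift k) = cvec K k.
Proof.
have E3 := three_eq0 char3.
have neg2 : -2 = 1 :> K by rewrite -[-2]addr0 -E3; ring.
have d2E : br2_phi (br2_lift 1) = cvec K 1.
  rewrite linearZ linearD /= !br2_phi_h.
  apply/coP => l l10; rewrite coZ !coD !coZ !co_cvec // !mxE /= neg2.
  have two1 : 2 + 1 = 0 :> K by rewrite -E3; ring.
  rewrite addrACA -mulrDl two1 mul0r add0r -mulrDl addrA addNr add0r.
  by rewrite mulrA mulrNN mulVf // mul1r.
do 10?[case: k => [|k] //]; move=> _ //.
all: rewrite ?br2_phi_lie ?br2_phi_x ?br2_phi_y.
- rewrite linearB linearN /= [X in _ - X]d2E br2_phi_h.
  apply/coP => l l10; rewrite coD !coN coD !coZ !co_cvec // !mxE /=.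
  by rewrite mulN1r opprD opprK addrK -mulNr neg2 mul1r.
all: try by [].
all: apply/coP; do 10?[case=> [_|]]; last by [].
all: rewrite co_lie !co_bracketE /minor2 ?co_lie ?co_bracketE /minor2 !co_cvec //=.
all: ring.
Qed.

End Identification.

(** * The kernel of [br2_phi] is the maximal graded ideal *)

Section Kernel.
Variables (K : fieldType) (char3 : 3%N \in [pchar K]) (eps : K).
Hypothesis eps_neq0 : eps != 0.
Local Notation M := (br2_model char3 eps).
Local Notation A := (br2_cartan eps).
Local Notation br2_phi := (@br2_phi K char3 eps).
Local Notation br2_lift := (br2_lift eps).

Definition br2_degree (k : nat) : 'rV[int]_2 :=
  (br2_root k).1 *: delta_mx 0 0 + (br2_root k).2 *: delta_mx 0 1.

Lemma br2_degreeE (d : 'rV[int]_2) k :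
  (d 0 0, d 0 1) = br2_root k -> d = br2_degree k.
Proof.
move=> dk; rewrite /br2_degree -dk; apply/rowP.
by elim/ord2P; rewrite !mxE /= ?mulr1 ?mulr0 ?addr0 ?add0r.
Qed.

Lemma br2_lift_homog k : (k < 10)%N -> tg_homog (br2_degree k) (br2_lift k).
Proof.
have linD (d : 'rV[int]_2) (u v : tilde_g A) :
    tg_homog d u -> tg_homog d v -> tg_homog d (u + v).
  by move=> du dv; rewrite -[u]scale1r; apply: tg_homog_lin.
have linZ (d : 'rV[int]_2) a (u : tilde_g A) : tg_homog d u -> tg_homog d (a *: u).
  by move=> du; rewrite -[_ *: _]addr0; apply: tg_homog_lin => //; apply: tg_homog0.
have d2h : tg_homog 0 (br2_lift 1) by apply/linZ/linD; apply: tg_homog_h.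
have x3h : tg_homog (delta_mx 0 0 + delta_mx 0 1) (br2_lift 4).
  by apply: tg_homog_lie; apply: tg_homog_x.
have y3h : tg_homog (- delta_mx 0 0 - delta_mx 0 1) (br2_lift 8).
  by apply: tg_homog_lie; apply: tg_homog_y.
have degE (d : 'rV[int]_2) j (u : tilde_g A) :
    (d 0 0, d 0 1) = br2_root j -> tg_homog d u -> tg_homog (br2_degree j) u.
  by move/br2_degreeE->.
do 10?[case: k => [|k] //]; move=> _ //.
- apply: (degE 0); first by rewrite !mxE.
  apply: linD; rewrite -scaleN1r; apply: linZ => //; exact: tg_homog_h.
- by apply: (degE 0) => //; rewrite !mxE.
- by apply: degE (tg_homog_x A 0); rewrite !mxE.
- by apply: degE (tg_homog_x A 1); rewrite !mxE.
- by apply: degE x3h; rewrite !mxE.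
- by apply: degE (tg_homog_lie (tg_homog_x A 1) x3h); rewrite !mxE.
- by apply: degE (tg_homog_y A 0); rewrite !mxE.
- by apply: degE (tg_homog_y A 1); rewrite !mxE.
- by apply: degE y3h; rewrite !mxE.
- by apply: degE (tg_homog_lie (tg_homog_y A 1) y3h); rewrite !mxE.
Qed.

(** A degree-preserving right inverse of [br2_phi]: it shows that [br2_phi] is onto and splits its
    kernel into homogeneous parts. *)
Definition br2_section (v : M) : tilde_g A := \sum_(k < 10) co v k *: br2_lift k.

Lemma br2_sectionK : cancel br2_section br2_phi.
Proof.
move=> v; rewrite linear_sum [RHS](co_sum v); apply: eq_bigr => k _.
by rewrite linearZ /= br2_phi_lift.
Qed.

Lemma br2_section_linear : linear br2_section.
Proof.
move=> a u v; rewrite scaler_sumr -big_split; apply: eq_bigr => k _ /=.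
by rewrite coD coZ scalerDl scalerA.
Qed.

HB.instance Definition _ :=
  GRing.isLinear.Build K M (tilde_g A) _ br2_section br2_section_linear.

Lemma br2_section_homog d v : br2_homog d v -> tg_homog d (br2_section v).
Proof.
move=> dv; apply: big_ind => [|u w du dw|k _].
- exact: tg_homog0.
- by rewrite -[u]scale1r; apply: tg_homog_lin.
- have [->|/(dv _ (ltn_ord k))/br2_degreeE->] := eqVneq (co v k) 0.
    by rewrite scale0r; apply: tg_homog0.
  rewrite -[_ *: _]addr0; apply: tg_homog_lin; last exact: tg_homog0.
  exact: br2_lift_homog.
Qed.

Lemma br2_phi_ker_max u : br2_phi u = 0 -> tg_max_ideal u.
Proof.
apply: (tg_max_ideal_in (I := fun u => br2_phi u = 0)).
- split=> [|a v w v0 w0|v w w0]; first exact: raddf0.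
    by rewrite linearP /= v0 w0 scaler0 addr0.
  by rewrite br2_phi_lie w0 lie0r.
- move=> {}u u0; have [s sP uE] := tg_homog_decomp u.
  (* A component w of u need not lie in the kernel, but w - [br2_section (br2_phi w)] does and has
     the same degree; the corrections add up to the section of [br2_phi u], which is 0. *)
  exists (size s), (fun k => (tnth (in_tuple s) k).1),
    (fun k => let w := (tnth (in_tuple s) k).2 in w - br2_section (br2_phi w)).
  split=> [k|].
    have /sP dw := mem_tnth k (in_tuple s); split=> /=.
      rewrite -scaleN1r addrC; apply: tg_homog_lin => //.
      exact/br2_section_homog/br2_phi_homog.
    by rewrite raddfB /= br2_sectionK subrr.
  rewrite sumrB -!linear_sum /= -(big_tnth _ _ s xpredT snd) -uE u0.
  by rewrite linear0 subr0.
- move=> c; rewrite linear_sum !big_ord_recl !big_ord0 !addr0 /= => cE.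
  have E j := congr1 (fun w : 'rV[K]_10 => co w j) cE.
  have := E 0%N; have {E} := E 1%N.
  rewrite !linearZ /= !br2_phi_h !co0 !coD !coZ !coD !coZ !co_cvec // !mxE /=.
  have -> : lift ord0 ord0 = 1 :> 'I_2 by apply: val_inj.
  move=> E1 E0.
  (* [E0] reads 2 (c_0 - c_1) = 0 and [E1] reads - c_0 + (1 - eps) c_1 = 0. Comparing the first with
     3 (c_0 - c_1) = 0 gives c_0 = c_1, and the second then leaves eps c_1 = 0. *)
  have c01 : c ord0 = c 1.
    apply/eqP; rewrite -subr_eq0; apply/eqP.
    have E3 : 3 * (c ord0 - c 1) = 0 by rewrite three_eq0 // mul0r.
    by rewrite -[LHS]subr0 -[X in _ - X = _]E3 -[RHS]oppr0 -[X in _ = - X]E0; ring.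
  have c1 : c 1 = 0.
    apply/eqP; rewrite -(mulrI_eq0 _ (mulfI eps_neq0)); apply/eqP.
    by rewrite -[RHS]oppr0 -[X in _ = - X]E1 c01; ring.
  by rewrite c01 c1 !scale0r addr0.
Qed.

Definition br2_opposite (k : nat) : nat := if (k < 6)%N then (k + 4)%N else (k - 4)%N.

Lemma br2_root_opposite k : (1 < k < 10)%N ->
  (br2_opposite k < 10)%N /\ br2_degree (br2_opposite k) = - br2_degree k.
Proof.
move=> /andP[k1 k10]; split; first by rewrite /br2_opposite; case: ifP; lia.
apply/esym/br2_degreeE.
do 10?[case: k k1 k10 => [|k] k1 k10 //].
all: rewrite !mxE /=.
all: by [].
Qed.

(** The torus part of the bracket is [co v k] times [e_{-k}, e_k]. That vector is nonzero: it has a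
    coordinate 1 or -1 for the first three positive roots and their opposites, and eps^2 up to sign
    for (1,2) and its opposite. *)
Lemma br2_lie_opposite (v : M) k : (1 < k < 10)%N ->
  lie (cvec K (br2_opposite k) : M) v = 0 -> co v k = 0.
Proof.
move=> /andP[k1 k10] lie_eq0.
have E j := congr1 (fun w : 'rV[K]_10 => co w j) lie_eq0.
have := E 0%N; have := E 1%N; rewrite !co_lie !co_bracketE /minor2 !co0.
move=> {E lie_eq0}; do 10?[case: k k1 k10 => [|k] k1 k10 //].
all: rewrite !co_cvec //=.
all: rewrite !(mul0r, mul1r, mulr0, sub0r, subr0, oppr0, add0r, addr0, mulrN).
all: move=> /eqP E1 /eqP E0; apply/eqP; move: E1 E0.
all: by rewrite ?(oppr_eq0, mulf_eq0, expf_eq0, negPf eps_neq0).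
Qed.

Lemma br2_max_phi_ker u : tg_max_ideal u -> br2_phi u = 0.
Proof.
elim=> [I {}u [I0 Ilin Ilie] Igr Itriv Iu||v w _ IHv _ IHw]; last 2 first.
- exact: raddf0.
- by rewrite linearD /= IHv IHw addr0.
suff homog0 d w : tg_homog d w -> I w -> br2_phi w = 0.
  have [m [d [w [dw ->]]]] := Igr _ Iu.
  by rewrite linear_sum big1 // => k _; case: (dw k) => /homog0.
move=> dw Iw; apply/coP => k k10; rewrite co0.
have [//|k_neq0] := eqVneq (co (br2_phi w) k) 0.
have dE := br2_degreeE (br2_phi_homog dw k10 k_neq0).
have deg0 v : tg_homog 0 v -> I v -> v = 0.
  by case/tg_homog_degree0=> c ->; apply: Itriv.
have [k1|k1] := ltnP 1 k; last first.
  rewrite [w]deg0 ?raddf0 ?co0 //.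
  rewrite (_ : 0 = d) // dE /br2_degree.
  by case: k k1 {k10 k_neq0 dE} => [|[|k]] //= _; rewrite !scale0r addr0.
have [opp10 opp_deg] := br2_root_opposite (introT andP (conj k1 k10)).
apply: br2_lie_opposite; first by rewrite k1.
rewrite -br2_phi_lift // -br2_phi_lie [lie _ w]deg0 ?raddf0 //; last exact: Ilie.
by have := tg_homog_lie (br2_lift_homog opp10) dw; rewrite opp_deg dE addNr.
Qed.

End Kernel.

(** * Vanishing of H^1 and H^2 in terms of single derivations and cocycles *)

Definition derivations_inner (K : fieldType) (L : lieAlgType K) : Prop :=
  forall D : L -> L, is_derivation D -> exists u, forall v, D v = lie u v.

Definition cocycles_exact (K : fieldType) (L : lieAlgType K) : Prop :=
  forall w : L -> L -> K^o, cochain2 w -> (forall u v t, d2 w u v t = 0) ->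
  exists2 f, cochain1 f & w = d1 f.

Section Vanishing.
Variables (K : fieldType) (L : lieAlgType K).

Lemma H1_adj_eq0 : derivations_inner L -> forall c : H1_adj L, c = 0.
Proof.
move=> innerL c; rewrite -[c]lmod_liftK -[RHS]lmod_proj0; apply/lmod_projP.
rewrite subr0; apply/asboolP; apply: innerL.
by have /asboolP := valP (lmod_lift c).
Qed.

Lemma H2_triv_eq0 : cocycles_exact L -> forall c : H2_triv L, c = 0.
Proof.
move=> exactL c; rewrite -[c]lmod_liftK -[RHS]lmod_proj0; apply/lmod_projP.
rewrite subr0; apply/asboolP.
by have /asboolP[wc wd] := valP (lmod_lift c); apply: exactL.
Qed.

Lemma derivation_sub_ad (D : L -> L) u :
  is_derivation D -> is_derivation (fun v => D v - lie u v).
Proof.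
move=> [Dl DL]; split=> [a v w|v w].
  by rewrite Dl lie_linearr opprD addrACA scalerBr.
rewrite DL lie_leibniz !lieDl !lieDr -!scaleN1r !lieZl !lieZr !scaleN1r.
by rewrite opprD addrACA.
Qed.

(** As [d1] carries a minus sign, the new form is [w - d1 f]. The added term is closed because f is
    applied to a Jacobi sum. *)
Lemma cocycle_add_exact (w : L -> L -> K^o) (f : L -> K^o) :
  cochain2 w -> (forall u v t, d2 w u v t = 0) -> cochain1 f ->
  cochain2 (fun u v => w u v + f (lie u v)) /\
  forall u v t, d2 (fun u v => w u v + f (lie u v)) u v t = 0.
Proof.
move=> [wr wl wa] wd fl.
have f0 : f 0 = 0.
  by have := fl (-1) 0 0; rewrite scaler0 addr0 scaleN1r addNr.
have fD u v : f (u + v) = f u + f v by have := fl 1 u v; rewrite !scale1r.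
have fN u : f (- u) = - f u.
  by apply: (addrI (f u)); rewrite -fD !subrr.
split; first split.
- move=> u a v t; rewrite wr lie_linearr fl scalerDr !addrA; congr (_ + _).
  by rewrite addrAC.
- move=> v a u t; rewrite (wl v a u t : w _ v = _) lie_linearl fl scalerDr.
  by rewrite !addrA; congr (_ + _); rewrite addrAC.
- by move=> u; rewrite wa liexx f0 addr0.
- move=> u v t.
  have J : - f (lie (lie u v) t) + f (lie (lie u t) v) - f (lie (lie v t) u) = 0.
    rewrite -!fN -!fD -[RHS]f0 -(lie_jacobi u v t); congr f.
    rewrite [lie (lie u t) v]lieC [lie u t]lieC -(scaleN1r (lie t u)) lieZr.
    by rewrite scaleN1r opprK -!lieC addrC [X in _ + X]addrC addrA.
  transitivity (d2 w u v t + 0); last by rewrite wd addr0.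
  by rewrite -J /d2 !opprD !addrA; ring.
Qed.

Lemma cochain2_alt (w : L -> L -> K^o) u v : cochain2 w -> w u v = - w v u.
Proof.
move=> [wr wl wa].
have wlD x y z : w (x + y) z = w x z + w y z.
  by have := wl z 1 x y; rewrite /= !scale1r.
have wrD x y z : w x (y + z) = w x y + w x z.
  by have := wr x 1 y z; rewrite !scale1r.
apply/eqP; rewrite -addr_eq0; apply/eqP.
by have := wa (u + v); rewrite wlD !wrD !wa add0r addr0.
Qed.

(** The cocycle identity expresses w([u, v], t) through values of w with u or v as an argument. *)
Lemma cocycle_radical_closed (w : L -> L -> K^o) u v :
  cochain2 w -> (forall u v t, d2 w u v t = 0) ->
  (forall t, w u t = 0) -> (forall t, w v t = 0) -> forall t, w (lie u v) t = 0.
Proof.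
move=> wc wd u0 v0 t; have := wd u v t; rewrite /d2.
rewrite [w (lie u t) v]cochain2_alt // [w (lie v t) u]cochain2_alt // u0 v0.
by rewrite !oppr0 !addr0 => /eqP; rewrite oppr_eq0 => /eqP.
Qed.

End Vanishing.

(** * Transport along an isomorphism of Lie algebras *)

Section Transport.
Variables (K : fieldType) (L L' : lieAlgType K) (f : {linear L -> L'}).
Variables (g : {linear L' -> L}) (fK : cancel f g) (gK : cancel g f).
Hypothesis f_lie : forall u v, f (lie u v) = lie (f u) (f v).

Let g_lie u v : g (lie u v) = lie (g u) (g v).
Proof. by rewrite -{1}[u]gK -{1}[v]gK -f_lie fK. Qed.

Lemma derivations_inner_iso : derivations_inner L' -> derivations_inner L.
Proof.
move=> innerL' D [Dl DL].
have [|u uD] := innerL' (fun v => f (D (g v))).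
  split=> [a u v|u v]; first by rewrite linearP Dl linearP.
  by rewrite g_lie DL linearD !f_lie !gK.
exists (g u) => v; apply: (can_inj fK).
by rewrite f_lie gK -uD fK.
Qed.

Lemma cocycles_exact_iso : cocycles_exact L' -> cocycles_exact L.
Proof.
move=> exactL' w [wr wl wa] wd.
have [||c cl cE] := exactL' (fun u v => w (g u) (g v)).
- split=> [u a v t|v a u t|u]; rewrite ?linearP ?wr ?wa //.
  exact: (wl (g v) a (g u) (g t)).
- by move=> u v t; rewrite /d2 !g_lie; apply: wd.
exists (c \o f) => [a u v|]; first by rewrite /= linearP cl.
apply/funext => u; apply/funext => v.
have := congr1 (fun w => w (f u) (f v)) cE.
by rewrite /= !fK /d1 -f_lie.
Qed.

End Transport.

(** * Derivations of the model *)

Section ModelCohomology.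
Variables (K : fieldType) (char3 : 3%N \in [pchar K]) (eps : K).
Hypothesis eps_neq0 : eps != 0.
Variable im : K.
Hypothesis imE : im * im = -1.
Local Notation M := (br2_model char3 eps).
Local Notation A := (br2_cartan eps).
Local Notation e k := (cvec K k : M).
Local Notation h := (br2_model_h char3 eps).
Local Notation x := (br2_model_x char3 eps).
Local Notation y := (br2_model_y char3 eps).

Lemma two_neq0 : 2 != 0 :> K.
Proof. by rewrite -(dvdn_pcharf char3). Qed.

(** Every vector is the image under [br2_phi] of its section, so the induction takes place in
    [tilde_g]. *)
Lemma br2_model_generated (P : M -> Prop) :
    P 0 -> (forall a u v, P u -> P v -> P (a *: u + v)) ->
    (forall u v, P u -> P v -> P (lie u v)) ->
    (forall i, P (x i)) -> (forall i, P (y i)) ->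
  forall v, P v.
Proof.
move=> P0 Plin Plie Px Py v; rewrite -[v](br2_sectionK eps_neq0).
elim/tg_generated: (br2_section _) => [|a u w|u w|i|i].
- by rewrite raddf0.
- by rewrite linearP; apply: Plin.
- by rewrite br2_phi_lie; apply: Plie.
- by rewrite br2_phi_x.
- by rewrite br2_phi_y.
Qed.

(** The eigenvalue of [br2_h0] on the root [z]. The factor 1 makes it an instance of the formula in
    [co_lie_torus]. *)
Definition br2_eig (z : int * int) : K := 1 * z.1%:~R + im * z.2%:~R.

Lemma br2_eigB z z' : br2_eig (z - z') = br2_eig z - br2_eig z'.
Proof. by rewrite /br2_eig !intrD !intrN; ring. Qed.

Lemma br2_eigD z z' : br2_eig (z + z') = br2_eig z + br2_eig z'.
Proof. by rewrite /br2_eig !intrD; ring. Qed.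

(* The norm form a^2 + b^2 of F_9 over F_3 vanishes only at 0. *)
Lemma br2_eig_neq0 z : ~~ (3 %| z.1 ^+ 2 + z.2 ^+ 2)%Z -> br2_eig z != 0.
Proof.
apply: contraNneq => eig0.
have : (z.1 ^+ 2 + z.2 ^+ 2)%:~R = 0 :> K.
  rewrite intrD !rmorphXn /=.
  have <- : br2_eig z * (z.1%:~R - im * z.2%:~R) = 0 by rewrite eig0 mul0r.
  by rewrite /br2_eig; ring: imE.
by move/eqP; rewrite -(dvdz_pcharf char3).
Qed.

Definition br2_h0 : M := 1 *: e 0 + im *: e 1.

Lemma co_lie_h0 (v : M) k : (k < 10)%N ->
  co (lie br2_h0 v) k = br2_eig (br2_root k) * co v k.
Proof. exact: co_lie_torus. Qed.

Lemma lie_h0 k : (k < 10)%N -> lie br2_h0 (e k) = br2_eig (br2_root k) *: e k.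
Proof.
move=> k10; apply/coP => l l10; rewrite co_lie_h0 // coZ !co_cvec //.
by case: (l =P k) => [->|_]; rewrite ?mulr0.
Qed.

Lemma br2_eig_root_neq0 k : (1 < k < 10)%N -> br2_eig (br2_root k) != 0.
Proof.
by case/andP=> k1 k10; apply: br2_eig_neq0; do 10?[case: k k1 k10 => [|k] k1 k10 //].
Qed.

(** The positions of the generators x_1, x_2, y_1, y_2. *)
Definition br2_simple (k : nat) : bool := k \in [:: 2; 3; 6; 7]%N.

(** Modulo 3 the root of a generator differs from the root at every other position; the norms of the
    differences are checked by computation. *)
Lemma br2_eig_sub_neq0 k l : br2_simple k -> (l < 10)%N -> l != k ->
  br2_eig (br2_root k) - br2_eig (br2_root l) != 0.
Proof.
move=> ks l10 lk; rewrite -br2_eigB; apply: br2_eig_neq0.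
have /allP/(_ k ks)/allP/(_ l) : all (fun k => all (fun l => (l != k) ==>
  ~~ (3 %| (br2_root k - br2_root l).1 ^+ 2 + (br2_root k - br2_root l).2 ^+ 2)%Z)
  (iota 0 10)) [:: 2; 3; 6; 7]%N by [].
by rewrite mem_iota lk /= => ->.
Qed.

(** Modulo 3 the negative of the root of a generator occurs only at the opposite position. *)
Lemma br2_eig_add_neq0 k l : br2_simple k -> (l < 10)%N -> l != br2_opposite k ->
  br2_eig (br2_root k) + br2_eig (br2_root l) != 0.
Proof.
move=> ks l10 lk; rewrite -br2_eigD; apply: br2_eig_neq0.
have /allP/(_ k ks)/allP/(_ l) : all (fun k => all (fun l => (l != br2_opposite k) ==>
  ~~ (3 %| (br2_root k + br2_root l).1 ^+ 2 + (br2_root k + br2_root l).2 ^+ 2)%Z)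
  (iota 0 10)) [:: 2; 3; 6; 7]%N by [].
by rewrite mem_iota lk /= => ->.
Qed.

Lemma br2_model_xP (P : M -> Prop) : P (e 2) -> P (e 3) -> forall i, P (x i).
Proof. by move=> P2 P3; elim/ord2P. Qed.

Lemma br2_model_yP (P : M -> Prop) : P (e 6) -> P (e 7) -> forall i, P (y i).
Proof. by move=> P6 P7; elim/ord2P. Qed.

(** Here [D br2_h0] lies in the torus, so [D h0, e_k] is a multiple of e_k. Applying D to [h0, e_k]
    and comparing coordinates [l] multiplies coordinate [l] of D e_k by a nonzero difference of
    eigenvalues and gives 0. *)
Lemma br2_model_derivation (D : M -> M) :
    is_derivation D -> (forall k, (1 < k < 10)%N -> co (D br2_h0) k = 0) ->
  forall k, br2_simple k -> D (e k) = co (D (e k)) k *: e k.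
Proof.
move=> [Dl DL] Dh k ks.
have k10 : (k < 10)%N by case/or4P: ks => [||| /orP[]] // /eqP->.
have D0E : D br2_h0 = co (D br2_h0) 0 *: e 0 + co (D br2_h0) 1 *: e 1.
  apply/coP => l l10; rewrite coD !coZ !co_cvec //.
  case: l l10 => [|[|l]] l10 /=.
  all: rewrite ?mulr0 ?mulr1 ?addr0 ?add0r //.
  exact: Dh.
apply/coP => l l10; rewrite coZ co_cvec //.
case: (l =P k) => [->|/eqP lk]; first by rewrite mulr1.
rewrite mulr0; apply/eqP; rewrite -(mulrI_eq0 _ (mulfI (br2_eig_sub_neq0 ks l10 lk))).
have DZ a v : D (a *: v) = a *: D v.
  have D0 : D 0 = 0 by have := Dl (-1) 0 0; rewrite scaler0 addr0 scaleN1r addNr.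
  by have := Dl a v 0; rewrite D0 !addr0.
have := congr1 (fun v : M => co v l) (DL br2_h0 (e k)).
rewrite lie_h0 // DZ coZ coD co_lie_h0 // D0E co_lie_torus // co_cvec //.
by rewrite (negPf lk) mulr0 add0r mulrBl => ->; rewrite subrr.
Qed.

Lemma br2_model_derivations_inner : derivations_inner M.
Proof.
move=> D dD.
(* Chosen so that [u0, h0] = - [h0, u0] agrees with D h0 at the root positions; on the torus the
   eigenvalue is 0 and the coefficient is set to 0. *)
pose c k := if (k < 2)%N then 0 else - co (D br2_h0) k / br2_eig (br2_root k).
pose u0 : M := \row_(k < 10) c k.
have u0E k : (1 < k < 10)%N -> co u0 k = - co (D br2_h0) k / br2_eig (br2_root k).
  by move=> /andP[k1 k10]; rewrite (co_row c) // /c ltnNge k1.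
have dD1 := derivation_sub_ad u0 dD; set D1 := (fun v => _) in dD1.
have D1h k : (1 < k < 10)%N -> co (D1 br2_h0) k = 0.
  move=> k10; rewrite /D1 lieC opprK coD co_lie_h0; last by case/andP: k10.
  by rewrite u0E // mulNr mulrN mulrC divfK ?subrr // br2_eig_root_neq0.
pose d k := co (D1 (e k)) k.
have D1E k : br2_simple k -> D1 (e k) = d k *: e k by apply: br2_model_derivation.
(* By duality [u1, x_1] = d(2) x_1 and [u1, x_2] = d(3) x_2, so subtracting ad u1 kills both x_i. *)
pose u1 : M := d 2 *: e 0 + d 3 *: e 1.
have dD2 := derivation_sub_ad u1 dD1; set D2 := (fun v => _) in dD2.
have D2E k : br2_simple k -> exists a, D2 (e k) = a *: e k.
  move=> ks; have k10 : (k < 10)%N by case/or4P: ks => [||| /orP[]] // /eqP->.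
  eexists; rewrite /D2 D1E //; apply/coP => l l10.
  rewrite coD coN co_lie_torus // !coZ !co_cvec //.
  case: (l =P k) => [->|_]; last by rewrite !mulr0 oppr0 addr0.
  by rewrite -mulrBl.
have D2x i : D2 (x i) = 0.
  apply: (br2_model_xP (P := fun v => D2 v = 0)); rewrite /D2 D1E //;
    apply/coP => l l10;
    rewrite coD coN co_lie_torus // !coZ !co_cvec // co0;
    case: eqP => [->|_]; rewrite ?mulr0 ?subrr //=; ring.
have D2y i : D2 (y i) = 0.
  have [a Da] : exists a, D2 (y i) = a *: y i.
    by apply: (br2_model_yP (P := fun v => exists a, D2 v = a *: v)); apply: D2E.
  have [_ DL] := dD2.
  have Dh : D2 (h i) = a *: h i.
    have := DL (x i) (y i); rewrite br2_model_xy eqxx D2x Da lie0l add0r lieZr.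
    by rewrite br2_model_xy eqxx.
  (* Applying D2 to [h_i, x_1] = A_{i1} x_1 yields a A_{i1} = 0. The first column (2, -2) of the
     Cartan matrix has no zero entry modulo 3, whereas 1 - eps may vanish. *)
  have := DL (h i) (x 0); rewrite br2_model_hx D2x Dh lie0r addr0 lieZl br2_model_hx.
  have D2Z b v : D2 (b *: v) = b *: D2 v.
    have [Dl _] := dD2.
    have D0 : D2 0 = 0 by have := Dl (-1) 0 0; rewrite scaler0 addr0 scaleN1r addNr.
    by have := Dl b v 0; rewrite D0 !addr0.
  rewrite D2Z D2x scaler0 => /(congr1 (fun v : M => co v 2)).
  rewrite co0 !coZ co_cvec //= mulr1 => /esym/eqP.
  have Ai0 : A i 0 != 0.
    by elim/ord2P: i {Da Dh}; rewrite !mxE /= ?oppr_eq0 two_neq0.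
  by rewrite mulf_eq0 (negPf Ai0) orbF Da => /eqP->; rewrite scale0r.
have D20 v : D2 v = 0.
  have [Dl DL] := dD2; elim/br2_model_generated: v => [|a u v u0' v0|u v u0' v0||] //.
  - by have := Dl (-1) 0 0; rewrite scaler0 addr0 scaleN1r addNr.
  - by rewrite Dl u0' v0 scaler0 addr0.
  - by rewrite DL u0' v0 lie0l lie0r addr0.
exists (u0 + u1) => v; rewrite lieDl; apply/eqP; rewrite -subr_eq0 opprD addrA.
exact/eqP/(D20 v).
Qed.

End ModelCohomology.

(** * 2-cocycles of the model *)

Section ModelCocycles.
Variables (K : fieldType) (char3 : 3%N \in [pchar K]) (eps : K).
Hypothesis eps_neq0 : eps != 0.
Variable im : K.
Hypothesis imE : im * im = -1.
Local Notation M := (br2_model char3 eps).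
Local Notation A := (br2_cartan eps).
Local Notation e k := (cvec K k : M).
Local Notation h := (br2_model_h char3 eps).
Local Notation x := (br2_model_x char3 eps).
Local Notation y := (br2_model_y char3 eps).
Local Notation h0 := (br2_h0 char3 eps im).
Local Notation eig k := (br2_eig im (br2_root k)).

Section Normalized.
Variable w : M -> M -> K^o.
Hypothesis w_cochain : cochain2 w.
Hypothesis w_cocycle : forall u v t, d2 w u v t = 0.
Hypothesis w_xy : forall i, w (x i) (y i) = 0.
Hypothesis w_h0 : forall k, (1 < k < 10)%N -> w h0 (e k) = 0.

Let wl (v : M) (a : K) (u t : M) : w (a *: u + t) v = a * w u v + w t v.
Proof. by case: w_cochain => _ + _; apply. Qed.

Let wr (v : M) (a : K) (u t : M) : w v (a *: u + t) = a * w v u + w v t.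
Proof. by case: w_cochain => + _ _; apply. Qed.

Let w0r (v : M) : w v 0 = 0.
Proof.
by have := wr v (-1) 0 0; rewrite scaler0 addr0 mulN1r addNr.
Qed.

Let w0l (v : M) : w 0 v = 0.
Proof.
by have := wl v (-1) 0 0; rewrite scaler0 addr0 mulN1r addNr.
Qed.

Let wZl (v : M) (a : K) (u : M) : w (a *: u) v = a * w u v.
Proof. by rewrite -[a *: u]addr0 wl w0l addr0. Qed.

Let wZr (v : M) (a : K) (u : M) : w v (a *: u) = a * w v u.
Proof. by rewrite -[a *: u]addr0 wr w0r addr0. Qed.

Let w_basis (u : M) : (forall k, (k < 10)%N -> w u (e k) = 0) -> forall v, w u v = 0.
Proof.
move=> u0 v; rewrite (co_sum v).
apply: (big_ind (fun v : M => w u v = 0)) => [|v1 v2 v10 v20|k _]; first exact: w0r.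
- by rewrite -[v1]scale1r wr v10 v20 mulr0 addr0.
- by rewrite wZr u0 ?mulr0.
Qed.

(** In the cocycle identity for h0, x_i, y_i two terms are multiples of w(x_i, y_i) = 0, which
    leaves w(h0, h_i) = 0; and the h_i span the torus. *)
Lemma normalized_h0 v : w h0 v = 0.
Proof.
have wh i : w h0 (h i) = 0.
  have i10 : (6 + i < 10)%N by case: i => [[|[|i]]].
  have hx : lie h0 (x i) = eig (2 + i)%N *: x i.
    by apply: lie_h0; apply: leq_ltn_trans i10; rewrite leq_add2r.
  have hy : lie h0 (y i) = eig (6 + i)%N *: y i by apply: lie_h0.
  have := w_cocycle h0 (x i) (y i); rewrite /d2 br2_model_xy eqxx hx hy !wZl w_xy.
  rewrite [w (y i) _]cochain2_alt // w_xy [w (h i) _]cochain2_alt //.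
  by rewrite oppr0 !mulr0 oppr0 !add0r opprK.
have := wh 1; have := wh 0; rewrite /br2_model_h !wr !wZr !mxE /= => h00 h01.
have w1 : w h0 (e 1) = 0.
  (* The sum of [h00] and [h01] is - eps w(h0, e_1) = 0. *)
  apply/eqP; rewrite -(mulrI_eq0 _ (mulfI eps_neq0)); apply/eqP.
  rewrite -[RHS]subr0 -[X in _ = X - _]oppr0 -[X in - X - _]h00 -[X in _ - X]h01.
  by ring.
have w0 : w h0 (e 0) = 0.
  apply/eqP; rewrite -(mulrI_eq0 _ (mulfI (two_neq0 char3))); apply/eqP.
  by move: h00; rewrite w1 mulr0 addr0.
apply: w_basis => -[|[|k]] k10 //; exact: w_h0.
Qed.

(** With h0 in the radical, the cocycle identity makes w invariant under ad h0, so it pairs only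
    weights of sum 0. *)
Lemma normalized_weight k l : (k < 10)%N -> (l < 10)%N ->
  eig k + eig l != 0 -> w (e k) (e l) = 0.
Proof.
move=> k10 l10 kl; apply/eqP; rewrite -(mulrI_eq0 _ (mulfI kl)) -oppr_eq0.
rewrite -(w_cocycle h0 (e k) (e l)) /d2 !lie_h0 // !wZl.
rewrite [w (lie _ _) _]cochain2_alt // normalized_h0 oppr0 subr0.
by rewrite (cochain2_alt (e l) (e k) w_cochain); apply/eqP; ring.
Qed.

(** By weights a generator can pair nontrivially only with the opposite one, and that value is 0 by
    [w_xy]. So the radical contains all generators. *)
Lemma normalized_eq0 u v : w u v = 0.
Proof.
have gen k : br2_simple k -> w (e k) (e (br2_opposite k)) = 0 ->
    forall t, w (e k) t = 0.
  move=> ks wk; have k10 : (k < 10)%N by case/or4P: ks => [||| /orP[]] // /eqP->.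
  apply: w_basis => l l10; have [->//|lk] := eqVneq l (br2_opposite k).
  by apply: normalized_weight => //; apply: br2_eig_add_neq0.
move: v; elim/(br2_model_generated (char3 := char3) eps_neq0):
  u => [|a u t u0 t0|u t u0 t0|i|i] v.
- exact: w0l.
- by rewrite wl u0 t0 mulr0 addr0.
- exact: cocycle_radical_closed.
- move: v; have := w_xy i; elim/ord2P: i => wi; apply: gen => //.
- move: v; have := w_xy i; rewrite cochain2_alt // => /eqP; rewrite oppr_eq0.
  by elim/ord2P: i => /eqP wi; apply: gen.
Qed.

End Normalized.

Lemma br2_model_cocycles_exact : cocycles_exact M.
Proof.
move=> w w_cochain w_cocycle.
(* The values f(d_1) = c0 and f(d_2) = c1 solve f(h_i) = - w(x_i, y_i) for both i; adding the two
   equations isolates eps c1. *)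
pose c1 : K := (w (x 0) (y 0) + w (x 1) (y 1)) / eps.
pose c0 : K := (c1 - w (x 0) (y 0)) / 2.
have c0E : 2 * c0 = c1 - w (x 0) (y 0) by rewrite mulrC divfK ?two_neq0.
have c1E : eps * c1 = w (x 0) (y 0) + w (x 1) (y 1) by rewrite mulrC divfK.
(* At a root position, w(h0, e_k) + f([h0, e_k]) = 0 forces f(e_k) to be - w(h0, e_k) divided by the
   eigenvalue. *)
pose c (k : nat) : K := if k is 0 then c0 else if k is 1 then c1 else
  - w h0 (e k) / eig k.
pose f (v : M) : K^o := \sum_(k < 10) co v k * c k.
have fl : cochain1 f.
  move=> a u v; rewrite /f scaler_sumr -big_split; apply: eq_bigr => k _ /=.
  by rewrite coD coZ mulrDl -mulrA.
have flM (a : K) (u v : M) : f (a *: u + v) = a * f u + f v by apply: fl.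
have fe k : (k < 10)%N -> f (e k) = c k.
  move=> k10; rewrite /f (bigD1 (Ordinal k10)) //= co_cvec // eqxx mul1r.
  rewrite big1 ?addr0 // => l /negPf lk; rewrite co_cvec //.
  by rewrite -[k]/(val (Ordinal k10)) val_eqE lk mul0r.
have [w'_cochain w'_cocycle] := cocycle_add_exact w_cochain w_cocycle fl.
have fZ (a : K) u : f (a *: u) = a * f u.
  have f0 : f 0 = 0 by have := fl (-1) 0 0; rewrite scaler0 addr0 scaleN1r addNr.
  by have := fl a u 0; rewrite f0 !addr0.
have w'0 := normalized_eq0 w'_cochain w'_cocycle.
exists f => //; apply/funext => u; apply/funext => v; rewrite /d1.
apply/eqP; rewrite -addr_eq0; apply/eqP/w'0 => [i|k k10].
  rewrite br2_model_xy eqxx; elim/ord2P: i.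
  - have -> : h 0 = 2 *: e 0 + -1 *: e 1 by rewrite /br2_model_h !mxE.
    rewrite flM fZ !fe // /c c0E; ring.
  - have -> : h 1 = -2 *: e 0 + (1 - eps) *: e 1 by rewrite /br2_model_h !mxE.
    rewrite flM fZ !fe // /c mulNr c0E mulrBl mul1r c1E; ring.
rewrite lie_h0; last by case/andP: k10.
rewrite fZ fe; last by case/andP: k10.
case: k k10 => [|[|k]] // k10; rewrite /c [_ * (_ / _)]mulrC divfK ?addrN //.
exact: br2_eig_root_neq0.
Qed.

End ModelCocycles.

(** * The isomorphism of [br2 eps] with the model, and the basis of the positive part *)

Section Isomorphism.
Variables (K : fieldType) (char3 : 3%N \in [pchar K]) (eps : K).
Hypothesis eps_neq0 : eps != 0.
Local Notation M := (br2_model char3 eps).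
Local Notation A := (br2_cartan eps).
Local Notation phi := (@br2_phi K char3 eps).
Local Notation sec := (@br2_section K char3 eps).

Definition br2_iso (p : br2 eps) : M := phi (lmod_lift p).
Definition br2_iso_inv (v : M) : br2 eps := gA_proj (sec v).

(** Two representatives of a class differ by an element of the maximal ideal, which [br2_phi]
    kills. *)
Lemma br2_iso_proj u : br2_iso (gA_proj u) = phi u.
Proof.
have /asboolP/(br2_max_phi_ker char3 eps_neq0) := @lmod_projK K _ (@tg_max K 2 A) u.
by rewrite raddfB => /eqP; rewrite subr_eq0 => /eqP.
Qed.

Lemma br2_iso_linear : linear br2_iso.
Proof.
move=> a p q; rewrite [p]gA_surj [q]gA_surj -gA_projE !br2_iso_proj.
exact: linearP.
Qed.

Lemma br2_iso_inv_linear : linear br2_iso_inv.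
Proof. by move=> a u v; rewrite /br2_iso_inv linearP gA_projE. Qed.

HB.instance Definition _ :=
  GRing.isLinear.Build K (br2 eps) M _ br2_iso br2_iso_linear.
HB.instance Definition _ :=
  GRing.isLinear.Build K M (br2 eps) _ br2_iso_inv br2_iso_inv_linear.

Lemma br2_iso_lie p q : br2_iso (lie p q) = lie (br2_iso p) (br2_iso q).
Proof.
rewrite [p]gA_surj [q]gA_surj -[lie _ _]/(gA_lie _ _) gA_lieE !br2_iso_proj.
exact: br2_phi_lie.
Qed.

Lemma br2_iso_invK : cancel br2_iso_inv br2_iso.
Proof. by move=> v; rewrite br2_iso_proj br2_sectionK. Qed.

Lemma br2_isoK : cancel br2_iso br2_iso_inv.
Proof.
move=> p; rewrite [RHS]gA_surj; apply/lmod_projP/asboolP.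
apply: (br2_phi_ker_max (char3 := char3) eps_neq0).
by rewrite raddfB /= br2_sectionK // subrr.
Qed.

(** In the rows of the table for positions outside 2, ..., 5, each entry involves a position outside
    this range, so vanishing there is preserved by brackets. *)
Lemma br2_iso_pos p k : gA_pos p -> (k < 10)%N -> ~~ (1 < k < 6)%N ->
  co (br2_iso p) k = 0.
Proof.
move=> pp; elim: pp k => {p} [i|p q _ IHp _ IHq||a p q _ IHp _ IHq] k k10 kNpos.
- rewrite br2_iso_proj br2_phi_x co_cvec //; case: eqP => // kE.
  by case/negP: kNpos; rewrite kE; case: i {kE} => [[|[|i]]].
- have p0 := (IHp 0%N isT isT, IHp 1%N isT isT, IHp 6%N isT isT, IHp 7%N isT isT,
              IHp 8%N isT isT, IHp 9%N isT isT).
  have q0 := (IHq 0%N isT isT, IHq 1%N isT isT, IHq 6%N isT isT, IHq 7%N isT isT,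
              IHq 8%N isT isT, IHq 9%N isT isT).
  rewrite br2_iso_lie co_lie; do 10?[case: k k10 kNpos => [|k] // k10 kNpos];
    by rewrite co_bracketE /minor2 !p0 !q0; ring.
- by rewrite raddf0 co0.
- by rewrite linearP coD coZ IHp // IHq // mulr0 addr0.
Qed.

Lemma br2_iso_x (j : 'I_4) :
  br2_iso (tnth [tuple br2_x1 eps; br2_x2 eps; br2_x3 eps; br2_x4 eps] j) =
  cvec K (2 + j).
Proof.
have x1E : br2_iso (br2_x1 eps) = cvec K 2 by rewrite br2_iso_proj br2_phi_x.
have x2E : br2_iso (br2_x2 eps) = cvec K 3 by rewrite br2_iso_proj br2_phi_x.
case: j => [[|[|[|[|j]]]] j4] //; rewrite (tnth_nth 0) /=.
- rewrite br2_iso_lie x1E x2E; apply/coP; do 10?[case=> [_|]]; last by [];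
    by rewrite co_lie co_bracketE /minor2 !co_cvec //=; ring.
(* The sign in x_4 turns - [x_2, [x_2, x_1]] into [x_2, x_3], the basis vector at position 5. *)
- rewrite raddfN /= !br2_iso_lie x1E x2E; apply/coP; do 10?[case=> [_|]]; last by [];
    by rewrite coN co_lie !co_bracketE /minor2 co_lie !co_bracketE /minor2
               !co_cvec //=; ring.
Qed.

Lemma br2_pos_basis : is_basis (@gA_pos K 2 A)
  [tuple br2_x1 eps; br2_x2 eps; br2_x3 eps; br2_x4 eps].
Proof.
set b := [tuple _; _; _; _].
have isoE (c : 'rV[K]_4) k : (k < 10)%N ->
    co (br2_iso (\sum_i c 0 i *: tnth b i)) k = \sum_(i < 4) c 0 i * (k == 2 + i)%N%:R.
  move=> k10; rewrite linear_sum.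
  rewrite (big_morph (fun v : M => co v k) (id1 := 0) (op1 := +%R)) => [|u v|].
  - by apply: eq_bigr => i _; rewrite linearZ /= coZ br2_iso_x co_cvec.
  - exact: coD.
  - exact: co0.
split.
  have x1 : gA_pos (br2_x1 eps) by apply: gA_pos_x.
  have x2 : gA_pos (br2_x2 eps) by apply: gA_pos_x.
  case=> [[|[|[|[|j]]]] j4] //; rewrite (tnth_nth 0) //=; first exact: gA_pos_lie.
  rewrite /br2_x4 -scaleN1r -[_ *: _]addr0; apply: gA_pos_lin; last exact: gA_pos0.
  by do !apply: gA_pos_lie.
have isoE2 (c : 'rV[K]_4) (j : 'I_4) :
    co (br2_iso (\sum_i c 0 i *: tnth b i)) (2 + j) = c 0 j.
  have j10 : (2 + j < 10)%N by have := ltn_ord j; lia.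
  rewrite isoE //.
  rewrite (bigD1 j) //= eqxx mulr1 big1 ?addr0 // => i /negPf ij.
  by rewrite eqn_add2l eq_sym val_eqE ij mulr0.
move=> u up; exists (\row_j co (br2_iso u) (2 + j)); split; last first.
  by move=> c ->; apply/rowP => j; rewrite mxE isoE2.
apply: (can_inj br2_isoK); apply/coP => k k10.
have [kpos|kNpos] := boolP (1 < k < 6)%N.
  have k4 : (k - 2 < 4)%N by lia.
  have -> : k = (2 + Ordinal k4)%N by rewrite /=; lia.
  by rewrite isoE2 mxE.
rewrite br2_iso_pos // isoE // big1 // => i _.
by case: eqP => [kE|]; rewrite ?mulr0 //; case/negP: kNpos; have := ltn_ord i; lia.
Qed.

Lemma br2_derivations_inner (im : K) : im * im = -1 -> derivations_inner (br2 eps).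
Proof.
move=> imE; apply: (derivations_inner_iso br2_isoK br2_iso_invK br2_iso_lie).
exact: br2_model_derivations_inner imE.
Qed.

Lemma br2_cocycles_exact (im : K) : im * im = -1 -> cocycles_exact (br2 eps).
Proof.
move=> imE; apply: (cocycles_exact_iso br2_isoK br2_iso_invK br2_iso_lie).
exact: br2_model_cocycles_exact imE.
Qed.

End Isomorphism.

Theorem lemma2p13 (K : closedFieldType) (char3 : 3%N \in [pchar K])
    (eps : K) (eps_neq0 : eps != 0) :
  [/\ is_basis (@gA_pos K 2 (br2_cartan eps))
        [tuple br2_x1 eps; br2_x2 eps; br2_x3 eps; br2_x4 eps],
      forall c : H1_adj (br2 eps), c = 0 &
      forall c : H2_triv (br2 eps), c = 0].
Proof.
have [im imE] : exists im : K, im * im = -1.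
  (* The coefficients -1 and 0 are those of the right-hand side of X^2 = -1 + 0 X. *)
  have [im] := solve_monicpoly (fun k => if k is 0 then -1 else 0 : K) (n := 2) isT.
  by rewrite !big_ord_recl big_ord0 expr2 /= mulr1 mul0r !addr0; exists im.
split.
- exact: br2_pos_basis.
- exact/H1_adj_eq0/(br2_derivations_inner char3 eps_neq0 imE).
- exact/H2_triv_eq0/(br2_cocycles_exact char3 eps_neq0 imE).
Qed.
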